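(* Let \( 1\leq p <\infty \). Then, under CH, the following isometric isomorphism holds: $L^{p}(\mu)\cong \ell^{p}(\mathfrak{c},L^{p}[0,1])$.
   Context: Let $\mathcal{B}$ be the Borel $\sigma$-algebra of $\mathbb{R}$, $\lambda$ the Lebesgue measure on $(\mathbb{R},\mathcal{B})$, and $\mathcal{B}_{\infty}$ the $\sigma$-algebra on $\mathbb{R}^{\mathbb{N}}$ generated by the cylinder sets $\prod_{i=1}^{m}C_{i}\times\prod_{i=m+1}^{\infty}\mathbb{R}$ with $C_i\in\mathcal{B}$, $m\in\mathbb{N}$ (it coincides with the Borel $\sigma$-algebra of the product topology). Let $\mathcal{F}(\mathcal{B},\lambda)$ be the set of finite rectangles $\prod_{i\in\mathbb{N}}C_{i}$ with $C_i\in\mathcal{B}$ and $\prod_{i\in\mathbb{N}}\lambda(C_i)\in[0,\infty)$, with $\mathrm{vol}(\prod_{i}C_i):=\prod_i\lambda(C_i)$. The measure $\mu$ is the restriction to $\mathcal{B}_{\infty}$ of the outer measure $\mu^{\ast}(A):=\inf\{\sum_{n}\mathrm{vol}(\mathscr{C}_{n}) : \mathscr{C}_{n}\in\mathcal{F}(\mathcal{B},\lambda),\ A\subset\bigcup_{n}\mathscr{C}_{n}\}$ (with $\inf\varnothing=\infty$). For a set $J$ and a Banach space $X$, $\ell^{p}(J,X)$ is the space of families $(x_j)_{j\in J}$ in $X$ with $\sum_{j}\|x_j\|^{p}<\infty$, normed by $(\sum_j\|x_j\|^p)^{1/p}$; $\mathfrak{c}$ is the cardinality of the continuum and CH is the continuum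 hypothesis. *)

(* Defs.v *)
From HB Require Import structures.
From mathcomp Require Import all_boot all_order all_algebra.
From mathcomp Require Import all_classical all_reals all_analysis.
Set Implicit Arguments. Unset Strict Implicit. Unset Printing Implicit Defensive.
Import Order.TTheory GRing.Theory Num.Theory.
Import numFieldNormedType.Exports.
Local Open Scope classical_set_scope.
Local Open Scope ring_scope.

Section BakerSpace.
Variable R : realType.

Definition cylinders : set (set (nat -> R)) :=
  [set A | exists (m : nat) (C : nat -> set R),
     (forall i, measurable (C i)) /\
     A = [set x | forall i, (i < m)%N -> C i (x i)]].

Definition RN := g_sigma_algebraType cylinders.

Definition rect (C : nat -> set R) : set RN := [set x | forall i, C i (x i)].

Definition partial_vol (C : nat -> set R) (n : nat) : \bar R :=
  (\prod_(i < n) (@lebesgue_measure R) (C i))%E.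

Definition vol (C : nat -> set R) : \bar R := lim (partial_vol C @ \oo).

Definition finite_rect (C : nat -> set R) : Prop :=
  (forall i, measurable (C i)) /\
  exists r : R, (0 <= r) /\ partial_vol C @ \oo --> r%:E.

(** The outer measure mu^* (inf over countable covers by finite rectangles;
    inf of the empty set is +oo). *)
Definition mu_star (A : set RN) : \bar R :=
  ereal_inf [set (\sum_(0 <= n <oo) vol (D n))%E |
               D in [set D : nat -> nat -> set R |
                      (forall n, finite_rect (D n)) /\
                      A `<=` \bigcup_n rect (D n)]].

(** mu: the restriction of mu^* to B_infty (integration only evaluates it
    on measurable sets). *)
Definition mu : set RN -> \bar R :=
  fun A => if `[< measurable A >] then mu_star A else 0%E.

Definition mu_ae (P : RN -> Prop) : Prop :=
  exists N : set RN, measurable N /\ mu N = 0%E /\ ~` [set x | P x] `<=` N.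

Definition Lp_mu (p : R) (f : RN -> R) : Prop :=
  measurable_fun [set: RN] f /\
  (\int[mu]_x ((`|f x| `^ p)%:E) < +oo)%E.

Definition Lp_mu_norm (p : R) (f : RN -> R) : \bar R :=
  poweR (\int[mu]_x ((`|f x| `^ p)%:E))%E p^-1.

Definition Lp01 (p : R) (g : R -> R) : Prop :=
  measurable_fun (`[0%R, 1%R] : set R) g /\
  (\int[@lebesgue_measure R]_(x in `[0%R, 1%R]) ((`|g x| `^ p)%:E) < +oo)%E.

Definition Lp01_norm (p : R) (g : R -> R) : \bar R :=
  poweR (\int[@lebesgue_measure R]_(x in `[0%R, 1%R]) ((`|g x| `^ p)%:E))%E p^-1.

Definition ae01_eq (g h : R -> R) : Prop :=
  {ae @lebesgue_measure R, forall x, (`[0%R, 1%R]%classic : set R) x -> g x = h x}.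

Definition lp_fam (J : choiceType) (p : R) (G : J -> R -> R) : Prop :=
  (forall j, Lp01 p (G j)) /\
  (\esum_(j in [set: J]) poweR (Lp01_norm p (G j)) p < +oo)%E.

Definition lp_fam_norm (J : choiceType) (p : R) (G : J -> R -> R) : \bar R :=
  poweR (\esum_(j in [set: J]) poweR (Lp01_norm p (G j)) p)%E p^-1.

Definition CH : Prop :=
  forall A : set R, countable A \/ (A #= [set: R])%card.

(** Isometric (real-)linear isomorphism  L^p(mu) ~= l^p(J, L^p[0,1]),
    both spaces being taken modulo a.e. equality. *)
Definition isometric_iso_Lp_mu_lp (J : choiceType) (p : R) : Prop :=
  exists T : (RN -> R) -> J -> R -> R,
    (forall f, Lp_mu p f -> lp_fam p (T f)) /\
    (forall f g, Lp_mu p f -> Lp_mu p g -> mu_ae (fun x => f x = g x) ->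
       forall j, ae01_eq (T f j) (T g j)) /\
    (forall (a b : R) f g, Lp_mu p f -> Lp_mu p g ->
       forall j, ae01_eq (T (fun x => a * f x + b * g x) j)
                         (fun t => a * T f j t + b * T g j t)) /\
    (forall f, Lp_mu p f -> lp_fam_norm p (T f) = Lp_mu_norm p f) /\
    (forall G, lp_fam p G -> exists f, Lp_mu p f /\
       forall j, ae01_eq (T f j) (G j)).

End BakerSpace.

(* Main.v *)
Require Import Defs.
From HB Require Import structures.
From mathcomp Require Import finmap.
From mathcomp Require Import all_boot all_order all_algebra.
From mathcomp Require Import all_classical all_reals all_analysis.
From mathcomp Require Import measurable_realfun lra.
Import Order.TTheory GRing.Theory Num.Theory.
Import numFieldNormedType.Exports.
Local Open Scope classical_set_scope.
Local Open Scope ring_scope.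
Set Implicit Arguments. Unset Strict Implicit. Unset Printing Implicit Defensive.

(** [mu] is a measure by Caratheodory's criterion: a finite rectangle split
    along one side stays a pair of finite rectangles whose volumes add up.
    Points are [mu]-null, and [R^N] is Borel-embedded in [R] with a Borel left
    inverse, so every set [E] with [0 < mu E < oo] is isomorphic, up to scaling
    and null sets, to [[0, 1]]: transport [mu] to [R] and use the distribution
    function and its quantile function.

    By Zorn's lemma there is a maximal family of sets of positive finite measure
    with pairwise null intersections.  Such sets are separated by the
    distribution functions of the embedding at rational points, so the family
    injects into [R].  It is uncountable, because each of its members meets only
    countably many of the uncountably many disjoint unit cubes
    [prod_i [b_i, b_i + 1[], each of which has measure 1.  By CH the family is
    thus indexed by [R].  A function in [L^p(mu)] has sigma-finite support, hence
    lives on countably many members of the family, and reading it on each member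
    through the isomorphism with [[0, 1]] is the isometry. *)

(** * Caratheodory's construction from the volumes of finite rectangles *)

Section outer_measure.
Context {R : realType}.
Local Open Scope ereal_scope.
Implicit Types (C : nat -> set R) (A : set (RN R)).

Lemma le_lebesgue (A B : set R) : measurable A -> measurable B -> A `<=` B ->
  lebesgue_measure A <= lebesgue_measure B.
Proof. by move=> mA mB AB; apply: le_measure => //; rewrite inE; assumption. Qed.

Lemma lebesgue_measureD (A B : set R) : measurable A -> measurable B ->
  lebesgue_measure (A `&` B) + lebesgue_measure (A `&` ~` B) = lebesgue_measure A.
Proof.
move=> mA mB; rewrite -setDE addeC -(measureDI (@lebesgue_measure R))//.
Qed.

Lemma finite_rect_cvg C : finite_rect C -> partial_vol C @ \oo --> vol C.
Proof. by move=> [_ [r [_ /[dup] h /cvg_lim rE]]]; rewrite /vol rE. Qed.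

Lemma vol_ge0 C : finite_rect C -> 0 <= vol C.
Proof. by move=> [_ [r [r0 h]]]; rewrite /vol (cvg_lim _ h)// lee_fin. Qed.

Lemma vol_fin_num C : finite_rect C -> vol C \is a fin_num.
Proof. by move=> [_ [r [r0 h]]]; rewrite /vol (cvg_lim _ h). Qed.

Lemma finite_rect_measurable C i : finite_rect C -> measurable (C i).
Proof. by case. Qed.

Lemma partial_vol_eq0 C j n : (j < n)%N -> lebesgue_measure (C j) = 0 ->
  partial_vol C n = 0.
Proof.
move=> jn Cj; rewrite /partial_vol (bigD1 (Ordinal jn))//= Cj mul0e//.
Qed.

(** As [0 * +oo = 0], the null side annihilates every partial product that reaches it, whatever the
    other sides are. *)
Lemma null_rect C j : (forall i, measurable (C i)) ->
  lebesgue_measure (C j) = 0 -> finite_rect C /\ vol C = 0.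
Proof.
move=> mC Cj; have h : partial_vol C @ \oo --> 0.
  apply: cvg_near_cst; exists j.+1 => // n /= jn.
  exact: partial_vol_eq0 Cj.
by split; [split => //; exists 0%R|exact/cvg_lim].
Qed.

Lemma mu_star_ge0 A : 0 <= mu_star A.
Proof.
apply: le_ereal_inf_tmp => _ [D [fD _] <-].
by apply: nneseries_ge0 => n _ _; exact: vol_ge0.
Qed.

Lemma le_mu_star : {homo @mu_star R : A B / A `<=` B >-> A <= B}.
Proof.
move=> A B AB; apply: ereal_inf_le_tmp => _ [D [fD BD] <-].
by exists D => //; split => //; exact: subset_trans BD.
Qed.

Lemma mu_star_rect C : finite_rect C -> mu_star (rect C) <= vol C.
Proof.
move=> fC; apply: ereal_inf_lbound.
have [fs vs] : finite_rect (fun=> set0 : set R) /\ vol (fun=> set0 : set R) = 0.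
  by apply: (@null_rect _ 0%N) => //; rewrite measure0.
exists (fun n => if n is 0%N then C else fun=> set0).
  split=> [[|n]//|x Cx]; by exists 0%N.
rewrite nneseries_recl//; last by case=> [|n] _; exact: vol_ge0.
by rewrite eseries_cond/= eseries0 ?adde0// => -[|].
Qed.

Lemma mu_star0 : mu_star (set0 : set (RN R)) = 0.
Proof.
apply/eqP; rewrite eq_le mu_star_ge0 andbT.
have [fs vs] : finite_rect (fun=> set0 : set R) /\ vol (fun=> set0 : set R) = 0.
  by apply: (@null_rect _ 0%N) => //; rewrite measure0.
by rewrite -vs; apply: le_trans (mu_star_rect fs); exact: le_mu_star.
Qed.

Lemma nneseries_pair (f : nat -> nat * nat) (a : nat * nat -> \bar R) :
  set_bij setT setT f -> (forall x, 0 <= a x) ->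
  \sum_(0 <= n <oo) a (f n) = \sum_(0 <= i <oo) \sum_(0 <= j <oo) a (i, j).
Proof.
move=> bf a0.
rewrite nneseries_esumT//.
rewrite -(reindex_esum [set: nat] [set: nat * nat] f)//.
transitivity (\esum_(i in [set: nat]) \esum_(j in [set: nat]) a (i, j)).
  rewrite esum_esum//; congr esum; last by apply/funext => -[].
  by apply/seteqP; split.
rewrite [RHS]nneseries_esumT => [|i]; last by apply: nneseries_ge0.
by apply: eq_esum => i _; rewrite nneseries_esumT.
Qed.

Lemma mu_star_sigma_subadditive : sigma_subadditive (@mu_star R).
Proof.
move=> A; apply/lee_addgt0Pr => e e0.
(* Near-optimal covers need a finite outer measure, so an infinite term is treated apart. *)
have [[i ioo]|Aoo] := pselect (exists i, mu_star (A i) = +oo).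
  rewrite (eseries_pinfty _ _ ioo) ?leey// => n _.
  by rewrite -ltNye (lt_le_trans _ (mu_star_ge0 _)).
rewrite (le_trans _ (epsilon_trick _ _ (ltW e0)))//; last first.
  by move=> n; exact: mu_star_ge0.
have [G PG] : {G : nat -> nat -> nat -> set R & forall n,
    [/\ forall k, finite_rect (G n k), A n `<=` \bigcup_k rect (G n k) &
      \sum_(0 <= k <oo) vol (G n k) <= mu_star (A n) + (e / (2 ^ n.+1)%:R)%:E]}.
  apply: (@choice _ _ (fun n (G : nat -> nat -> set R) =>
    [/\ forall k, finite_rect (G k), A n `<=` \bigcup_k rect (G k) &
    \sum_(0 <= k <oo) vol (G k) <= mu_star (A n) + (e / (2 ^ n.+1)%:R)%:E])) => n.
  have An : mu_star (A n) \is a fin_num.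
    by rewrite ge0_fin_numE ?mu_star_ge0// ltey; apply: contra_notN Aoo => /eqP ?; exists n.
  have en : (0 < e / (2 ^ n.+1)%:R)%R by rewrite divr_gt0// ltr0n expn_gt0.
  have [_ [D [fD AD] <-] /ltW ?] := lb_ereal_inf_adherent en An.
  by exists D.
(* A bijection between [nat] and [nat * nat] merges the covers [G n] into one sequence. *)
have /card_esym/ppcard_eqP[f] := card_nat2.
have bf : set_bij setT setT f := bij.
apply: (@le_trans _ _ (\sum_(0 <= n <oo) vol (G (f n).1 (f n).2))).
  apply: ereal_inf_lbound; exists (fun n => G (f n).1 (f n).2) => //.
  split=> [n|x [n _ Anx]]; first by have [] := PG (f n).1.
  have [_ /(_ _ Anx)[k _ Gx] _] := PG n.
  have [_ _ /(_ (n, k) I)[m _ fm]] := bf.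
  by exists m => //; rewrite fm.
rewrite (nneseries_pair (a := fun x => vol (G x.1 x.2)) bf) => [|x]; last first.
  by apply: vol_ge0; have [] := PG x.1.
apply: lee_nneseries => [i _ _|i _].
  by apply: nneseries_ge0 => j _ _; apply: vol_ge0; have [] := PG i.
by have [] := PG i.
Qed.

HB.instance Definition _ := isOuterMeasure.Build R (RN R) (@mu_star R)
  mu_star0 mu_star_ge0 le_mu_star mu_star_sigma_subadditive.

Definition set_side C (i : nat) (B : set R) : nat -> set R :=
  fun j => if j == i then C i `&` B else C j.

Lemma measurable_set_side C i B : measurable B ->
  (forall j, measurable (C j)) -> forall j, measurable (set_side C i B j).
Proof. by move=> mB mC j; rewrite /set_side; case: ifP => // _; exact: measurableI. Qed.

Lemma rect_set_side C i B :
  rect (set_side C i B) = rect C `&` [set x : RN R | B (x i)].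
Proof.
apply/seteqP; split=> x.
  move=> h; split=> [j|].
    by have := h j; rewrite /set_side; case: ifPn => // /eqP -> [].
  by have := h i; rewrite /set_side eqxx => -[].
by move=> [Cx Bx] j; rewrite /set_side; case: ifPn => // /eqP ->.
Qed.

Lemma partial_vol_set_side C i B n : (i < n)%N ->
  partial_vol (set_side C i B) n =
  lebesgue_measure (C i `&` B) * \prod_(j < n | j != i :> nat) lebesgue_measure (C j).
Proof.
move=> ltin; rewrite /partial_vol (bigD1 (Ordinal ltin))//= /set_side eqxx.
congr (_ * _); apply: eq_big => // j; by rewrite -val_eqE/= => /negbTE ->.
Qed.

Lemma partial_vol_side C i n : (i < n)%N ->
  partial_vol C n =
  lebesgue_measure (C i) * \prod_(j < n | j != i :> nat) lebesgue_measure (C j).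
Proof. by move=> ltin; rewrite /partial_vol (bigD1 (Ordinal ltin)). Qed.

(** If [c] is the proportion of side [i] inside [B], the partial products of the two pieces are
    eventually [c] and [1 - c] times those of [C], so they converge and their limits add up. *)
Lemma finite_rect_split C i B : measurable B -> finite_rect C ->
  [/\ finite_rect (set_side C i B), finite_rect (set_side C i (~` B)) &
      vol (set_side C i B) + vol (set_side C i (~` B)) = vol C].
Proof.
move=> mB fC; have [mC [r [r0 Cr]]] := fC.
have mBC : measurable (~` B) by exact: measurableC.
suff [c [c0 c1 hB hC]] : exists c : R, [/\ (0 <= c)%R, (c <= 1)%R,
    \forall n \near \oo, partial_vol (set_side C i B) n = c%:E * partial_vol C n &
    \forall n \near \oo, partial_vol (set_side C i (~` B)) n =
                         (1 - c)%:E * partial_vol C n].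
  have lB : partial_vol (set_side C i B) @ \oo --> (c * r)%:E.
    rewrite EFinM; apply: cvg_trans (cvgeZl _ Cr) => //; apply: near_eq_cvg.
    by move: hB; apply: filterS => n ->.
  have lC : partial_vol (set_side C i (~` B)) @ \oo --> ((1 - c) * r)%:E.
    rewrite EFinM; apply: cvg_trans (cvgeZl _ Cr) => //; apply: near_eq_cvg.
    by move: hC; apply: filterS => n ->.
  split.
  - split; first exact: measurable_set_side.
    by exists (c * r)%R; split => //; exact: mulr_ge0.
  - split; first exact: measurable_set_side.
    by exists ((1 - c) * r)%R; split => //; rewrite mulr_ge0// subr_ge0.
  - rewrite /vol (cvg_lim _ lB)// (cvg_lim _ lC)// (cvg_lim _ Cr)// -EFinD.
    by rewrite -mulrDl addrC subrK mul1r.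
have leI D : measurable D -> lebesgue_measure (C i `&` D) <= lebesgue_measure (C i).
  by move=> mD; apply: le_lebesgue => //; exact: measurableI.
have [Ci0|Ci0] := eqVneq (lebesgue_measure (C i)) 0.
  have Ci0I D : measurable D -> lebesgue_measure (C i `&` D) = 0.
    by move=> mD; apply/eqP; rewrite eq_le measure_ge0 andbT -Ci0 leI.
  (* All partial products past [i] vanish, so any [c] in [[0, 1]] would do. *)
  exists 1%R; split => //; exists i.+1 => // n /= ltin;
    by rewrite partial_vol_set_side// (partial_vol_eq0 ltin Ci0) mule0 Ci0I// mul0e.
have [Cioo|Cioo] := eqVneq (lebesgue_measure (C i)) +oo.
  (* A finite volume with an infinite side forces another side to be null. *)
  have [j ji Cj0] : exists2 j, j != i & lebesgue_measure (C j) = 0.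
    have : \forall n \near \oo, partial_vol C n \is a fin_num.
      by case/fine_cvgP : Cr.
    case=> N _ /(_ (maxn N i.+1)).
    rewrite /= leq_maxl => /(_ isT).
    set n := maxn N i.+1.
    have ltin : (i < n)%N by rewrite leq_maxr.
    rewrite (partial_vol_side _ ltin) Cioo.
    have [//|noj] := pselect (exists2 j, j != i & lebesgue_measure (C j) = 0).
    rewrite gt0_mulye// lt0e prode_ge0// andbT.
    apply: (big_ind (fun x => x != 0)) => [|x y x0 y0|j ji].
    - by rewrite onee_neq0.
    - by rewrite mule_eq0 negb_or x0.
    - by apply: contra_notN noj => /eqP Cj; exists (val j).
  exists 1%R; split => //; exists (maxn i.+1 j.+1) => // n /=;
    rewrite geq_max => /andP[ltin ltjn].
  - rewrite (partial_vol_eq0 ltjn Cj0) mule0.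
    by apply: (partial_vol_eq0 ltjn); rewrite /set_side (negbTE ji).
  - rewrite (partial_vol_eq0 ltjn Cj0) mule0.
    by apply: (partial_vol_eq0 ltjn); rewrite /set_side (negbTE ji).
have Cif : lebesgue_measure (C i) \is a fin_num.
  by rewrite ge0_fin_numE ?measure_ge0// ltey.
have Bf D : measurable D -> lebesgue_measure (C i `&` D) \is a fin_num.
  by move=> mD; rewrite ge0_fin_numE ?measure_ge0// (le_lt_trans (leI _ mD))// ltey.
pose m := fine (lebesgue_measure (C i)).
have m0 : (0 < m)%R by rewrite fine_gt0// lt0e Ci0 measure_ge0/= ltey.
have sum_m : (fine (lebesgue_measure (C i `&` B)) +
    fine (lebesgue_measure (C i `&` ~` B)) = m)%R.
  rewrite -fineD ?Bf// /m; congr fine.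
  exact: lebesgue_measureD.
exists (fine (lebesgue_measure (C i `&` B)) / m)%R; split.
- by apply: divr_ge0; [exact: fine_ge0|exact: ltW].
- by rewrite ler_pdivrMr// mul1r -sum_m lerDl fine_ge0.
- exists i.+1 => // n /= ltin.
  rewrite partial_vol_set_side// (partial_vol_side _ ltin) muleA; congr (_ * _).
  by rewrite -[X in _ * X]fineK// -EFinM divfK ?gt_eqF// fineK// Bf.
- exists i.+1 => // n /= ltin.
  rewrite partial_vol_set_side// (partial_vol_side _ ltin) muleA; congr (_ * _).
  rewrite -[X in _ * X]fineK// -EFinM mulrBl mul1r divfK ?gt_eqF//.
  by rewrite -/m -sum_m addrAC subrr add0r fineK// Bf.
Qed.

(** Cutting each rectangle of a cover of [X] along side [i] yields covers of the two parts of [X]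
    with the same total volume. *)
Lemma caratheodory_side i (B : set R) : measurable B ->
  (@mu_star R).-caratheodory [set x | B (x i)].
Proof.
move=> mB; apply: (@le_caratheodory_measurable R _ (@mu_star R)) => X.
apply: le_ereal_inf_tmp => _ [D [fD XD] <-].
have sp n := finite_rect_split i mB (fD n).
rewrite (eq_eseriesr (fun n _ => esym (let: And3 _ _ h := sp n in h))).
rewrite nneseriesD; last 2 first.
- by move=> n _ _; apply: vol_ge0; case: (sp n).
- by move=> n _ _; apply: vol_ge0; case: (sp n).
apply: leeD; apply: ereal_inf_lbound.
- exists (fun n => set_side (D n) i B) => //; split.
    by move=> n; case: (sp n).
  by move=> x [/XD[n _ Dx] Bx]; exists n => //; rewrite rect_set_side.
- exists (fun n => set_side (D n) i (~` B)) => //; split.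
    by move=> n; case: (sp n).
  by move=> x [/XD[n _ Dx] Bx]; exists n => //; rewrite rect_set_side.
Qed.

(** The Caratheodory sets form a sigma-algebra, and each generating cylinder is a finite
    intersection of one-coordinate conditions. *)
Lemma measurable_caratheodory A :
  measurable A -> (@mu_star R).-caratheodory A.
Proof.
apply: smallest_sub.
  exact: (@sigma_algebra_measurable _ (caratheodory_type (@mu_star R))).
move=> _ [m [C [mC ->]]].
rewrite (_ : [set x | _] = \bigcap_(i in [set i | (i < m)%N]) [set x | C i (x i)])//.
have : forall i, [set i | (i < m)%N] i ->
    measurable ([set x | C i (x i)] : set (caratheodory_type (@mu_star R))).
  by move=> i _; exact: caratheodory_side.
exact: bigcap_measurableType.
Qed.

Lemma muE A : measurable A -> mu A = mu_star A.
Proof. by move=> mA; rewrite /mu asboolT. Qed.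

Lemma mu_set0 : mu (set0 : set (RN R)) = 0.
Proof. by rewrite muE// mu_star0. Qed.

Lemma mu_ge0 A : 0 <= mu A.
Proof. by rewrite /mu; case: ifP => // _; exact: mu_star_ge0. Qed.

Lemma mu_sigma_additive : semi_sigma_additive (@mu R).
Proof.
move=> F mF tF mUF; rewrite muE//.
rewrite (_ : (fun n => _) = (fun n => \sum_(0 <= i < n) mu_star (F i))).
  apply: (@caratheodory_measure_sigma_additive _ _ (@mu_star R)) => //.
  - by move=> i; exact: measurable_caratheodory.
  - exact: measurable_caratheodory.
by apply/funext => n; apply: eq_bigr => i _; rewrite muE.
Qed.

HB.instance Definition _ := isMeasure.Build _ (RN R) R (@mu R)
  mu_set0 mu_ge0 mu_sigma_additive.

End outer_measure.

(** * Lower bound for the outer measure of unit cubes *)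

Section unit_cube.
Context {R : realType}.
Local Open Scope ereal_scope.
Notation lam := (@lebesgue_measure R).

(** Otherwise the series is at least 1 on all of [J], and integrating it term by term over [J],
    which has mass 1, gives a total of at least 1. *)
Lemma ex_sum_indic_lt1 (J : set (measurableTypeR R))
    (B : nat -> set (measurableTypeR R)) (w : nat -> \bar R) :
  measurable J -> lam J = 1 -> (forall n, measurable (B n)) ->
  (forall n, 0 <= w n) -> \sum_(n <oo) lam (J `&` B n) * w n < 1 ->
  exists2 y, J y & \sum_(n <oo) (\1_(B n) y)%:E * w n < 1.
Proof.
move=> mJ J1 mB w0; rewrite ltNge; apply: contraNP => noy.
have {}noy y : J y -> 1 <= \sum_(n <oo) (\1_(B n) y)%:E * w n.
  by move=> Jy; rewrite leNgt; apply/negP => ?; apply: noy; exists y.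
have w0' n y : 0 <= (\1_(B n) y)%:E * w n by rewrite mule_ge0// lee_fin.
have mBn n : measurable_fun J (fun y => ((\1_(B n) y)%:E * w n : \bar R)).
  apply: emeasurable_funM => //.
  by apply/measurable_EFinP; exact: measurable_indic.
rewrite [leRHS](_ : _ = \int[lam]_(y in J) \sum_(n <oo) (\1_(B n) y)%:E * w n).
  rewrite -[leLHS]J1 -[leLHS]mul1e -(integral_cst _ mJ).
  apply: ge0_le_integral => //.
  by apply: ge0_emeasurable_sum => //.
rewrite integral_nneseries//; apply: eq_eseriesr => n _.
rewrite ge0_integralZr//.
- by rewrite integral_indic// setIC.
- by apply/measurable_EFinP; exact: measurable_indic.
Qed.

(* Fubini one coordinate at a time: as long as the conditional volumes of the
   cylinders still meeting the prefix [x_0, ..., x_(k-1)] sum to less than 1,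
   some [x_k] keeps them so; the limit point then avoids every cylinder. *)
Lemma unit_cube_cylinder_cover (J : nat -> set R) (E : nat -> nat -> set R)
    (m : nat -> nat) :
  (forall i, measurable (J i)) -> (forall i, lam (J i) = 1) ->
  (forall n i, measurable (E n i)) -> (forall n i, (m n <= i)%N -> E n i = setT) ->
  rect J `<=` \bigcup_n rect (E n) ->
  1 <= \sum_(n <oo) \prod_(0 <= i < m n) lam (J i `&` E n i).
Proof.
move=> mJ J1 mE Em JE; rewrite leNgt; apply/negP => lt1.
(* [t n k] is the conditional volume of cylinder [n] once the first [k] coordinates are fixed; in
   [S k A], the set [A] collects the cylinders still compatible with them. *)
pose t n k := \prod_(k <= i < m n) lam (J i `&` E n i).
have t0 n k : 0 <= t n k by apply: prode_ge0.
pose S k (A : set nat) := \sum_(n <oo) (\1_A n : R)%:E * t n k.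
have tS n k : lam (J k `&` E n k) * t n k.+1 = t n k.
  rewrite /t; have [kn|nk] := ltnP k (m n); first by rewrite [RHS]big_ltn.
  by rewrite !big_geq// ?(leqW nk)// Em// setIT J1 mul1e.
(* The existential stands outside the implication so that [choice] applies to every pair
   [(k, A)]. *)
have step k A : exists y, S k A < 1 ->
    J k y /\ S k.+1 (A `&` [set n | E n k y]) < 1.
  have [Sk|] := pselect (S k A < 1); last by exists point.
  have [||y Jy h] := @ex_sum_indic_lt1 (J k) (fun n => E n k)
      (fun n => (\1_A n)%:E * t n k.+1) (mJ k) (J1 k) (fun n => mE n k).
  - by move=> n; rewrite mule_ge0// lee_fin.
  - rewrite (eq_eseriesr (g := fun n => (\1_A n)%:E * t n k))// => n _.
    by rewrite muleCA tS.
  exists y => _; split => //; move: h; rewrite /S.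
  rewrite (eq_eseriesr (g := fun n =>
    (\1_(A `&` [set n | E n k y]) n)%:E * t n k.+1))// => n _.
  rewrite muleA -EFinM; congr (_%:E * _).
  rewrite indicI/= mulrC; congr (_ * _)%R.
have [Y hY] := choice (fun kA : nat * set nat => step kA.1 kA.2).
pose A := fix A k := if k is k'.+1 then A k' `&` [set n | E n k' (Y (k', A k'))] else setT.
pose x k := Y (k, A k).
have SA k : S k (A k) < 1.
  elim: k => [|k IH]; last by have [] := hY (k, A k) IH.
  rewrite /S (eq_eseriesr (g := fun n => t n 0%N))// => n _.
  by rewrite indicT mul1e.
have Jx : rect J x by move=> k; have [] := hY (k, A k) (SA k).
have [n _ Enx] := JE _ Jx.
have An k : A k n by elim: k => //= k IH; split => //; exact: Enx.
(* At stage [m n] the surviving cylinder [n] has no side left: its term is the empty product 1, so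
   [S] is not below 1. *)
have := SA (m n); rewrite ltNge => /negP; apply.
rewrite /S (@nneseriesD1 _ _ n)//; last first.
  by move=> i _; rewrite mule_ge0// lee_fin.
rewrite indicE mem_set// mul1e /t big_geq// leeDl//.
by apply: nneseries_ge0 => i _ _; apply: mule_ge0 => //; exact: (t0 i (m n)).
Qed.

(** Each rectangle is truncated at an index where its partial product exceeds its volume by at most
    [e / 2 ^ n.+1]; the resulting cylinders still cover the cube. *)
Lemma mu_star_unit_cube (J : nat -> set R) : (forall i, measurable (J i)) ->
  (forall i, lam (J i) = 1) -> 1 <= mu_star (rect J).
Proof.
move=> mJ J1; apply: le_ereal_inf_tmp => _ [D [fD JD] <-].
apply/lee_addgt0Pr => e e0.
rewrite (le_trans _ (epsilon_trick _ _ (ltW e0)))//; last first.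
  by move=> n; exact: vol_ge0.
have [m hm] : {m : nat -> nat & forall n,
    partial_vol (D n) (m n) <= vol (D n) + (e / (2 ^ n.+1)%:R)%:E}.
  apply: (@choice _ _ (fun n m =>
    partial_vol (D n) m <= vol (D n) + (e / (2 ^ n.+1)%:R)%:E)) => n.
  have en : (0 < e / (2 ^ n.+1)%:R)%R by rewrite divr_gt0// ltr0n expn_gt0.
  have h := finite_rect_cvg (fD n).
  have : vol (D n) < vol (D n) + (e / (2 ^ n.+1)%:R)%:E.
    by rewrite lteDl// vol_fin_num.
  move=> lt_vol; have [N _ /(_ N (leqnn N))/ltW ?] := h _
    (open_ereal_lt_ereal lt_vol).
  by exists N.
pose E n i := if (i < m n)%N then D n i else setT.
have mE n i : measurable (E n i).
  by rewrite /E; case: ifP => // _; exact: finite_rect_measurable.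
have JE : rect J `<=` \bigcup_n rect (E n).
  by move=> x /JD[n _ Dx]; exists n => // i; rewrite /E; case: ifP.
have Em n i : (m n <= i)%N -> E n i = setT by rewrite /E ltnNge => ->.
apply: le_trans (unit_cube_cylinder_cover mJ J1 mE Em JE) _.
apply: lee_nneseries => [n _ _|n _]; first exact: prode_ge0.
apply: le_trans (hm n); rewrite big_mkord.
suff : 0 <= \prod_(i < m n) lam (J i `&` E n i) <= partial_vol (D n) (m n).
  by case/andP.
apply: (big_ind2 (fun x y => 0 <= x <= y)) => [|x y x' y' /andP[? ?] /andP[? ?]|i _].
- by rewrite lexx andbT.
- by rewrite mule_ge0//= lee_pmul.
rewrite measure_ge0/= /E ltn_ord; apply: le_lebesgue => //.
- by apply: measurableI => //; exact: finite_rect_measurable.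
- exact: finite_rect_measurable.
Qed.

End unit_cube.

(** * Coding bit sequences by reals *)

Section ternary_code.
Context {R : realType}.
Implicit Types (b : nat -> bool) (t : R).

(** Using only the digits 0 and 1 in base 3 keeps tails small, so that no real has two expansions
    and the digits can be read back. *)
Definition ternary_series b : nat -> R := series (fun k => (b k)%:R / 3 ^+ k.+1).

Definition ternary_code b : R := limn (ternary_series b).

Lemma ternary_series_nd b : nondecreasing_seq (ternary_series b).
Proof.
by apply: nondecreasing_series => n _ _; rewrite divr_ge0// exprn_ge0.
Qed.

Lemma ternary_series_le b n : ternary_series b n <= 2^-1.
Proof.
(* The induction needs the exact geometric bound, since [2^-1] alone is not inductive. *)
suff : ternary_series b n <= 2^-1 * (1 - (3 ^+ n)^-1).
  move=> /le_trans; apply; rewrite ler_piMr// lerBlDr lerDl invr_ge0.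
elim: n => [|n IH].
  by rewrite /ternary_series /series/= big_geq// expr0 invr1 subrr mulr0.
rewrite /ternary_series seriesSr.
have : (b n)%:R / 3 ^+ n.+1 <= (3 ^+ n.+1)^-1 :> R.
  by rewrite ler_piMl// ?invr_ge0 ?exprn_ge0//; case: (b n).
move: IH; rewrite -/(ternary_series b n).
have -> : (3 ^+ n)^-1 = 3 * (3 ^+ n.+1)^-1 :> R.
  by rewrite exprS invfM mulrA divff// mul1r.
by set w := (3 ^+ n.+1)^-1; lra.
Qed.

Lemma cvg_ternary_code b : ternary_series b @ \oo --> ternary_code b.
Proof.
apply: nondecreasing_is_cvgn; first exact: ternary_series_nd.
by exists 2^-1 => _ [n _ <-]; exact: ternary_series_le.
Qed.

Lemma ternary_code_ge0 b : 0 <= ternary_code b.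
Proof.
apply: limr_ge; first by apply/cvg_ex; eexists; exact: cvg_ternary_code.
by apply: nearW => n; apply: sumr_ge0 => k _; rewrite divr_ge0// exprn_ge0.
Qed.

Lemma ternary_code_le b : ternary_code b <= 2^-1.
Proof.
apply: limr_le; first by apply/cvg_ex; eexists; exact: cvg_ternary_code.
by apply: nearW => n; exact: ternary_series_le.
Qed.

Lemma ternary_codeS b :
  3 * ternary_code b = (b 0%N)%:R + ternary_code (fun k => b k.+1).
Proof.
have E n : 3 * ternary_series b n.+1 = (b 0%N)%:R + ternary_series (fun k => b k.+1) n.
  rewrite /ternary_series /series/= big_nat_recl// mulrDr expr1 mulrCA divff// mulr1.
  rewrite mulr_sumr; congr (_ + _); apply: eq_bigr => k _.
  by rewrite mulrCA; congr (_ * _); rewrite exprS invfM mulrA divff// mul1r.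
have h1 : 3 * ternary_series b n.+1 @[n --> \oo] --> 3 * ternary_code b.
  by apply: cvgMr; rewrite (cvg_shiftS (ternary_series b)); exact: cvg_ternary_code.
have h2 : 3 * ternary_series b n.+1 @[n --> \oo] -->
    (b 0%N)%:R + ternary_code (fun k => b k.+1).
  under eq_fun do rewrite E.
  by apply: cvgD; [exact: cvg_cst|exact: cvg_ternary_code].
exact: cvg_unique h1 h2.
Qed.

Definition ternary_shift t : R := 3 * t - (1 <= 3 * t)%R%:R.

Definition ternary_digit n t : bool := 1 <= 3 * iter n ternary_shift t.

(** The tail adds at most 1/2 to [3 * ternary_code b], so comparison with 1 sees only the leading
    digit. *)
Lemma ternary_digit0 b : (1 <= 3 * ternary_code b) = b 0%N.
Proof.
have := ternary_code_ge0 (fun k => b k.+1); have := ternary_code_le (fun k => b k.+1).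
rewrite ternary_codeS; case: (b 0%N) => /= h1 h2.
  by rewrite lerDl.
by rewrite add0r; apply/negbTE; rewrite -ltNge (le_lt_trans h1)// invf_lt1// ltr1n.
Qed.

Lemma ternary_digitK b n : ternary_digit n (ternary_code b) = b n.
Proof.
rewrite /ternary_digit.
suff -> : iter n ternary_shift (ternary_code b) = ternary_code (fun k => b (n + k)%N).
  by rewrite ternary_digit0 addn0.
elim: n => [//|n IH]; rewrite iterS IH /ternary_shift ternary_digit0.
rewrite ternary_codeS addn0 addrAC subrr add0r; congr ternary_code.
by apply/funext => k; rewrite addSnnS.
Qed.

Lemma measurable_ternary_shift : measurable_fun [set: R] ternary_shift.
Proof.
have m3 : measurable_fun [set: R] (fun t : R => 3 * t).
  exact: measurable_funM.
apply: measurable_funB => //.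
rewrite (_ : (fun t => _) = (fun b : bool => b%:R : R) \o (fun t : R => 1 <= 3 * t))//.
apply: measurableT_comp => //.
by apply: measurable_fun_ler.
Qed.

Lemma measurable_ternary_digit n : measurable_fun [set: R] (ternary_digit n).
Proof.
apply: measurable_fun_ler => //; apply: measurable_funM => //.
elim: n => [|n IH]; first exact: measurable_id.
by apply: measurableT_comp IH; exact: measurable_ternary_shift.
Qed.

Lemma measurable_ternary_code d (T : measurableType d) (f : T -> nat -> bool) :
  (forall n, measurable_fun [set: T] (fun x => f x n)) ->
  measurable_fun [set: T] (fun x => ternary_code (f x)).
Proof.
move=> mf; apply: (@measurable_fun_cvg _ _ _ _ (fun n x => ternary_series (f x) n)).
  move=> n; apply: measurable_sum => k; apply: measurable_funM => //.
  exact: (@measurableT_comp _ _ _ _ _ _ (fun b : bool => b%:R : R) _ (f ^~ k)).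
by move=> x _; exact: cvg_ternary_code.
Qed.

End ternary_code.

(** * A Borel embedding of the sequence space in the line *)

Section real_code.
Context {R : realType}.

Lemma measurable_coord (i : nat) : measurable_fun [set: RN R] (fun x : RN R => x i : R).
Proof.
move=> _ B mB; rewrite setTI; apply: sub_sigma_algebra.
exists i.+1, (fun j => if j == i then B else setT); split.
  by move=> j; case: ifP.
apply/seteqP; split=> x /= h; last by have := h i (leqnn _); rewrite eqxx.
by move=> j _; case: ifPn => // /eqP ->.
Qed.

Lemma measurable_RN d (T : measurableType d) (f : T -> RN R) :
  (forall i, measurable_fun [set: T] (fun x => f x i : R)) ->
  measurable_fun [set: T] f.
Proof.
move=> mf; apply: (@measurability _ _ T (RN R) setT f (@cylinders R)) => //.
move=> _ [_ [m [C [mC ->]]] <-]; rewrite setTI.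
rewrite (_ : _ @^-1` _ =
  \bigcap_(i in [set i | (i < m)%N]) ((fun x => f x i : R) @^-1` (C i)))//.
apply: bigcap_measurableType => i _.
by rewrite -[X in measurable X]setTI; exact: mf.
Qed.

(** The bits record the Dedekind cuts of all coordinates, listed through pairs of a coordinate and a
    rational. *)
Definition RN_bits (x : RN R) (n : nat) : bool :=
  if unpickle n is Some iq then ratr (iq : nat * rat).2 < (x : nat -> R) iq.1 else false.

Definition RN_code (x : RN R) : R := ternary_code (RN_bits x).

(** Rationals whose bit is off contribute [-oo], neutral for the supremum in [RN_decode]. *)
Definition RN_decode_seq (i n : nat) (t : R) : \bar R :=
  if unpickle n is Some q then
    (if ternary_digit (pickle (i, q : rat)) t then (ratr q)%:E else -oo%E)
  else -oo%E.

Definition RN_decode (t : R) : RN R :=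
  fun i => fine (esups (fun n => RN_decode_seq i n t) 0).

Lemma measurable_RN_code : measurable_fun [set: RN R] RN_code.
Proof.
apply: measurable_ternary_code => n; rewrite /RN_bits.
case: unpickle => [[i q]|//]; apply: measurable_fun_ltr => //.
exact: measurable_coord.
Qed.

Lemma measurable_RN_decode : measurable_fun [set: R] RN_decode.
Proof.
apply: measurable_RN => i; apply: measurableT_comp => //.
apply: measurable_fun_esups => n; rewrite /RN_decode_seq.
case: unpickle => [q|//]; apply: measurable_fun_ifT => //.
exact: measurable_ternary_digit.
Qed.

(** By density, each coordinate is the supremum of the rationals strictly below it, the ones whose
    bit is on. *)
Lemma RN_codeK : cancel RN_code RN_decode.
Proof.
move=> x; apply/funext => i; rewrite /RN_decode.
rewrite (_ : esups _ _ = ((x : nat -> R) i)%:E)//.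
have dE n : RN_decode_seq i n (RN_code x) =
    if unpickle n is Some q then
      (if ratr q < (x : nat -> R) i then (ratr q)%:E else -oo%E) else -oo%E.
  rewrite /RN_decode_seq; case: unpickle => // q.
  by rewrite ternary_digitK /RN_bits pickleK.
apply/eqP; rewrite eq_le; apply/andP; split.
  apply: ge_ereal_sup => _ [n _ <-]; rewrite dE; case: unpickle => [q|]; last exact: leNye.
  by case: ifPn => [/ltW|_]; [rewrite lee_fin|exact: leNye].
apply/lee_subgt0Pr => e e0.
have /rat_in_itvoo[q] : (x : nat -> R) i - e < (x : nat -> R) i.
  by rewrite ltrBlDr ltrDl.
rewrite in_itv/= => /andP[q1 q2].
apply: (@le_trans _ _ (ratr q)%:E); first by rewrite -EFinB lee_fin ltW.
apply: ereal_sup_ubound; exists (pickle q) => //.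
by rewrite dE pickleK q2.
Qed.

End real_code.

(** * Measures on the line and their values on open rays *)

Section measures_on_reals.
Context {R : realType}.
Local Open Scope ereal_scope.
Notation TR := (measurableTypeR R).
Notation lam := (@lebesgue_measure R).

(** Rational rays are stable under intersection, generate the Borel sets and exhaust the line, so
    uniqueness of measures applies. *)
Lemma eq_measure_rat_rays (m1 m2 : {measure set TR -> \bar R}) :
  m1 setT < +oo ->
  (forall q : rat, m1 `]-oo, ratr q[%classic = m2 `]-oo, ratr q[%classic) ->
  forall A, measurable A -> m1 A = m2 A.
Proof.
move=> fin1 m12.
pose G : set (set TR) := [set `]-oo, (ratr q : R)[%classic | q in [set: rat]].
have mG A : G A -> measurable A by move=> [q _ <-]; exact: measurable_itv.
apply: (measure_unique G (fun n => `]-oo, (n%:R : R)[%classic)).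
- rewrite RGenInftyO.measurableE; apply/seteqP; split.
    apply: smallest_sub; first exact: smallest_sigma_algebra.
    move=> _ [x ->].
    rewrite (_ : `]-oo, x[%classic =
        \bigcup_q (if (ratr q <= x)%R then `]-oo, (ratr q : R)[%classic else set0)).
      apply: (@bigcupT_measurable_rat _ (g_sigma_algebraType G)) => q.
      by case: ifP => // _; apply: sub_sigma_algebra; exists q.
    apply/seteqP; split=> [y|y [q _]] /=.
      rewrite in_itv/= => /rat_in_itvoo[q]; rewrite in_itv/= => /andP[yq qx].
      by exists q => //; rewrite (ltW qx)/= in_itv/=.
    case: ifP => // qx; rewrite /= !in_itv/= => yq.
    exact: lt_le_trans qx.
  apply: smallest_sub; first exact: smallest_sigma_algebra.
  by move=> _ [q _ <-]; apply: sub_sigma_algebra; eexists.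
- move=> _ _ [q _ <-] [r _ <-]; exists (Num.min q r) => //.
  apply/seteqP; split=> x /=; rewrite !in_itv/=.
    have : (ratr (Num.min q r) : R) = Num.min (ratr q) (ratr r).
      by case: (leP q r) => qr; [rewrite min_l// ler_rat|rewrite min_r// ler_rat ltW].
    by move=> ->; rewrite lt_min => /andP[].
  by case: (leP q r) => _ [].
- by move=> n; exists n%:R => //; rewrite ratr_nat.
- apply/seteqP; split=> // x _; exists (Num.bound `|x|) => //=.
  by rewrite in_itv/= (le_lt_trans (ler_norm x))// archi_boundP.
- by move=> _ [q _ <-].
- move=> k; apply: le_lt_trans fin1; apply: le_measure; rewrite ?inE//.
Qed.

Lemma ray_bigcup_le (m : {measure set TR -> \bar R}) (s : nat -> R) (b : \bar R) :
  nondecreasing_seq s -> (forall n, m `]-oo, s n[%classic <= b) ->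
  m (\bigcup_n `]-oo, s n[%classic) <= b.
Proof.
move=> nds mb.
have h := @nondecreasing_cvg_mu _ _ _ m (fun n => `]-oo, s n[%classic).
have /h {}h : forall i, measurable (`]-oo, s i[%classic : set TR).
  by move=> i; exact: measurable_itv.
have /h {}h : measurable (\bigcup_n (`]-oo, s n[%classic : set TR)).
  by apply: bigcupT_measurable => i; exact: measurable_itv.
have /h {}h : nondecreasing_seq (fun n => `]-oo, s n[%classic : set TR).
  move=> i j /nds sij; apply/subsetPset => x /=; rewrite !in_itv/= => /lt_le_trans.
  exact.
rewrite -(cvg_lim _ h)//; apply: lime_le; first by apply/cvg_ex; eexists; exact: h.
exact: nearW.
Qed.

Lemma ray_bigcap_ge (m : {measure set TR -> \bar R}) (s : nat -> R) (b : \bar R) :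
  m setT < +oo -> nonincreasing_seq s -> (forall n, b <= m `]-oo, s n[%classic) ->
  b <= m (\bigcap_n `]-oo, s n[%classic).
Proof.
move=> mT nds mb.
have h := @nonincreasing_cvg_mu _ _ _ m (fun n => `]-oo, s n[%classic).
have mI i : measurable (`]-oo, s i[%classic : set TR) by exact: measurable_itv.
have /h {}h : m `]-oo, s 0%N[%classic < +oo.
  by apply: le_lt_trans mT; apply: le_measure; rewrite ?inE.
have /h {}h := mI.
have /h {}h : measurable (\bigcap_n (`]-oo, s n[%classic : set TR)).
  exact: bigcapT_measurable.
have /h {}h : nonincreasing_seq (fun n => `]-oo, s n[%classic : set TR).
  move=> i j /nds sij; apply/subsetPset => x /=; rewrite !in_itv/= => /lt_le_trans.
  exact.
rewrite -(cvg_lim _ h)//; apply: lime_ge; first by apply/cvg_ex; eexists; exact: h.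
exact: nearW.
Qed.

(** The endpoints are null; this passes to the open interval, where the quantile function is
    meaningful. *)
Lemma lebesgue_measure_cc_oo (A : set R) : measurable A ->
  lam (`[0%R, 1%R] `&` A) = lam (`]0%R, 1%R[ `&` A).
Proof.
move=> mA.
have mo : measurable (`]0%R, 1%R[%classic `&` A : set TR).
  by apply: measurableI => //; exact: measurable_itv.
have mc : measurable (`[0%R, 1%R]%classic `&` A : set TR).
  by apply: measurableI => //; exact: measurable_itv.
apply/eqP; rewrite eq_le; apply/andP; split; last first.
  apply: le_measure; rewrite ?inE//; apply: setSI => x /=.
  by rewrite !in_itv/= => /andP[? ?]; rewrite !ltW.
apply: (@le_trans _ _ (lam ((`]0%R, 1%R[%classic `&` A) `|` [set 0%R; 1%R]))).
  apply: le_measure; rewrite ?inE//; first by apply: measurableU => //; exact: measurableU.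
  move=> x [/=]; rewrite in_itv/= => /andP[x0 x1] Ax.
  have [->|x0'] := eqVneq x 0%R; first by right; left.
  have [->|x1'] := eqVneq x 1%R; first by right; right.
  by left; split => //=; rewrite in_itv/= !lt_neqAle x0 x1 eq_sym x0' x1'.
apply: le_trans (measureU2 _ _ _) _ => //; first exact: measurableU.
have l0 (x : R) : lam [set x] = 0 by exact: lebesgue_measure_set1.
rewrite -[leRHS]adde0 leeD2l//.
apply: le_trans (measureU2 _ _ _) _ => //.
by rewrite [X in X + _](l0 0%R) [X in _ + X](l0 1%R) adde0.
Qed.

End measures_on_reals.

Section image_measure.
Context d1 d2 (T1 : measurableType d1) (T2 : measurableType d2) (R : realType).

Definition image_measure (m : {measure set T1 -> \bar R}) (f : T1 -> T2)
    (mf : measurable_fun [set: T1] f) : {measure set T2 -> \bar R} :=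
  measure_function_pushforward__canonical__measure_function_Measure m mf.

Lemma image_measureE m f mf A : @image_measure m f mf A = m (f @^-1` A).
Proof. by []. Qed.

End image_measure.

(** * Distribution and quantile functions of an atomless finite measure *)

Section quantile.
Context {R : realType}.
Local Open Scope ereal_scope.
Notation TR := (measurableTypeR R).
Notation lam := (@lebesgue_measure R).
Variable nu : {measure set TR -> \bar R}.
Hypotheses (nuT0 : 0 < nu setT) (nuT : nu setT < +oo) (nu1 : forall x, nu [set x] = 0).

Let c := fine (nu setT).

Let c_gt0 : (0 < c)%R. Proof. by rewrite fine_gt0// nuT0. Qed.

Let cE : nu setT = c%:E.
Proof. by rewrite fineK// ge0_fin_numE. Qed.

Let mray (t : R) : measurable (`]-oo, t[%classic : set TR).
Proof. exact: measurable_itv. Qed.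

(** The distribution function normalised to total mass 1; open rays make it left continuous. *)
Definition ray_mass (t : R) : R := (fine (nu `]-oo, t[%classic) / fine (nu setT))%R.

Lemma ray_massE t : nu `]-oo, t[%classic = (ray_mass t * c)%:E.
Proof.
rewrite /ray_mass -/c divfK ?gt_eqF// fineK// ge0_fin_numE//.
by apply: le_lt_trans nuT; apply: le_measure; rewrite ?inE.
Qed.

Lemma ray_mass_nd : nondecreasing_fun ray_mass.
Proof.
move=> s t st; rewrite -(ler_pM2r c_gt0) -lee_fin -!ray_massE.
apply: le_measure; rewrite ?inE//; move=> x /=; rewrite !in_itv/= => /lt_le_trans.
exact.
Qed.

Lemma ray_mass_ge0 t : (0 <= ray_mass t)%R.
Proof. by rewrite -(pmulr_lge0 _ c_gt0) -lee_fin -ray_massE. Qed.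

Lemma ray_mass_le1 t : (ray_mass t <= 1)%R.
Proof.
rewrite -(ler_pM2r c_gt0) mul1r -lee_fin -ray_massE -cE.
by apply: le_measure; rewrite ?inE.
Qed.

(** The upper quantile: by left continuity of [ray_mass] the supremum is attained, which makes the
    two functions adjoint. Outside []0, 1[] the value 0 is a default. *)
Definition quantile (u : R) : R :=
  if (0 < u < 1)%R then sup [set t | (ray_mass t <= u)%R] else 0%R.

(** An empty set would leave mass at least [u * c] on rays shrinking to nothing; an unbounded one
    would bound the total mass [c] by [u * c]. *)
Lemma has_sup_quantile u : (0 < u < 1)%R -> has_sup [set t | (ray_mass t <= u)%R].
Proof.
move=> /andP[u0 u1]; split.
- apply: contrapT => no.
  have : (u * c)%:E <= nu (\bigcap_n `]-oo, (- n%:R : R)%R[%classic).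
    apply: ray_bigcap_ge => //; first by move=> i j ij; rewrite lerN2 ler_nat.
    move=> n; rewrite ray_massE lee_fin ler_pM2r// leNgt; apply/negP => h.
    by apply: no; exists (- n%:R)%R; exact: ltW.
  rewrite (_ : \bigcap_n _ = set0); last first.
    apply/seteqP; split => // x /(_ (Num.bound `|x|) I) /=; rewrite in_itv/=.
    rewrite ltrNr => /lt_le_trans/(_ (ler_norm (- x)%R)).
    by rewrite normrN ltNge ltW// archi_boundP.
  by rewrite measure0 lee_fin leNgt mulr_gt0.
- apply: contrapT => no.
  have : nu (\bigcup_n `]-oo, (n%:R : R)[%classic) <= (u * c)%:E.
    apply: ray_bigcup_le; first by move=> i j ij; rewrite ler_nat.
    move=> n; rewrite ray_massE lee_fin ler_pM2r// leNgt; apply/negP => h.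
    apply: no; exists n%:R => t /= tu; rewrite leNgt; apply/negP => nt.
    by move: h; rewrite ltNge => /negP; apply; exact: le_trans (ray_mass_nd (ltW nt)) tu.
  rewrite (_ : \bigcup_n _ = setT); last first.
    apply/seteqP; split=> // x _; exists (Num.bound `|x|) => //=.
    by rewrite in_itv/= (le_lt_trans (ler_norm x))// archi_boundP.
  by rewrite cE lee_fin leNgt gtr_pMl// u1.
Qed.

(** The ray below the supremum is a union of rays ending strictly earlier, each of mass at most
    [u * c] by monotonicity. *)
Lemma ray_mass_quantile_le u : (0 < u < 1)%R -> (ray_mass (quantile u) <= u)%R.
Proof.
move=> u01; rewrite /quantile u01.
set S := [set t | _]; have hS : has_sup S := has_sup_quantile u01.
rewrite -(ler_pM2r c_gt0) -lee_fin -ray_massE.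
rewrite (_ : `]-oo, sup S[%classic = \bigcup_n `]-oo, (sup S - n.+1%:R^-1)%R[%classic).
  apply: ray_bigcup_le.
    by move=> i j ij; rewrite lerB// lef_pV2 ?posrE// ler_nat.
  move=> n; rewrite ray_massE lee_fin ler_pM2r//.
  have [t St] : exists2 t, S t & (sup S - n.+1%:R^-1 < t)%R.
    by apply: sup_adherent => //; rewrite invr_gt0.
  by move=> /ltW /ray_mass_nd /le_trans; apply.
apply/seteqP; split=> [x|x [n _]] /=; rewrite !in_itv/=.
  move=> xS; have /ltr_add_invr[k] := xS.
  by move=> h; exists k => //=; rewrite in_itv/= ltrBrDr.
by move=> /lt_le_trans; apply; rewrite lerBlDr lerDl invr_ge0.
Qed.

Lemma ray_mass_le_quantile u t : (0 < u < 1)%R ->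
  (ray_mass t <= u)%R = (t <= quantile u)%R.
Proof.
move=> u01; apply/idP/idP => [tu|/ray_mass_nd tq].
  rewrite /quantile u01; apply: ub_le_sup => //.
  by case: (has_sup_quantile u01).
exact: le_trans tq (ray_mass_quantile_le u01).
Qed.

(** Absence of atoms gives the missing inequality: rays ending just above [q] have mass at least
    [u * c] and shrink to the closed ray at [q], whose endpoint is null. *)
Lemma quantileK u : (0 < u < 1)%R -> ray_mass (quantile u) = u.
Proof.
move=> u01; apply/eqP; rewrite eq_le ray_mass_quantile_le//=.
rewrite -(ler_pM2r c_gt0) -lee_fin -ray_massE.
set q := quantile u.
have h : (u * c)%:E <= nu (\bigcap_n `]-oo, (q + n.+1%:R^-1)%R[%classic).
  apply: ray_bigcap_ge => //.
    by move=> i j ij; rewrite lerD2l lef_pV2 ?posrE// ler_nat.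
  move=> n; rewrite ray_massE lee_fin ler_pM2r// leNgt; apply/negP => /ltW.
  by rewrite ray_mass_le_quantile// leNgt ltrDl invr_gt0 ltr0n.
apply: (le_trans h).
rewrite (_ : \bigcap_n _ = `]-oo, q[%classic `|` [set q]).
  by apply: le_trans (measureU2 _ _ _) _ => //; rewrite [X in _ + X](nu1 q) adde0.
apply/seteqP; split=> [x xq|x].
  have : (x <= q)%R.
    rewrite leNgt; apply/negP => /ltr_add_invr[k qk].
    by have := xq k I; rewrite /= in_itv/= ltNge ltW.
  by rewrite le_eqVlt => /predU1P[->|]; [right|left => //=; rewrite in_itv].
move=> xq n _ /=; rewrite in_itv/=; apply: (@le_lt_trans _ _ q).
  by case: xq => [/=|->//]; rewrite in_itv/= => /ltW.
by rewrite ltrDl invr_gt0.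
Qed.

Lemma quantile_preimage t :
  `]0%R, 1%R[ `&` quantile @^-1` `]-oo, t[ = `]0%R, ray_mass t[%classic.
Proof.
apply/seteqP; split=> u /=; rewrite !in_itv/=.
  by move=> [u01]; rewrite ltNge -ray_mass_le_quantile// -ltNge; case/andP: u01 => ->.
move=> /andP[u0 ut].
have u01 : (0 < u < 1)%R by rewrite u0 (lt_le_trans ut)// ray_mass_le1.
by split => //; rewrite ltNge -ray_mass_le_quantile// -ltNge.
Qed.

Lemma measurable_quantile : measurable_fun [set: TR] (quantile : TR -> TR).
Proof.
apply: (measurability _ (RGenInftyO.measurableE R)) => _ [_ [t ->] <-].
rewrite setTI.
(* Outside []0, 1[] the quantile is 0, which lies in the ray exactly when [0 < t]. *)
rewrite (_ : _ @^-1` _ = `]0%R, ray_mass t[%classic `|`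
    (if (0 < t)%R then ~` `]0%R, 1%R[%classic else set0)).
  apply: measurableU; first exact: measurable_itv.
  by case: ifP => // _; apply: measurableC; exact: measurable_itv.
rewrite -quantile_preimage; apply/seteqP; split=> u /=.
  move=> qt; have [u01|u01] := boolP (0 < u < 1)%R.
    by left; split => //=; rewrite in_itv.
  right; move: qt; rewrite /quantile (negbTE u01) in_itv/= => ->.
  by move=> /=; rewrite in_itv/=; exact/negP.
move=> [[]//|]; case: ifP => // t0 /=; rewrite in_itv/= => /negP u01.
by rewrite /quantile (negbTE u01) in_itv.
Qed.

(** Both sides are finite measures in [A]; on rays they agree because [quantile_preimage] gives an
    interval of length [ray_mass]. *)
Lemma pushforward_quantile A : measurable A ->
  lam (`[0%R, 1%R] `&` quantile @^-1` A) * nu setT = nu A.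
Proof.
move=> mA.
have mQ A' : measurable A' -> measurable (quantile @^-1` A' : set TR).
  by move=> mA'; rewrite -[X in measurable X]setTI; exact: measurable_quantile.
rewrite lebesgue_measure_cc_oo; last exact: mQ.
have m01 : measurable (`]0%R, 1%R[%classic : set TR) by exact: measurable_itv.
pose m1 : {measure set TR -> \bar R} := mscale (NngNum (ltW c_gt0)) 
  (image_measure (mrestr lam m01) measurable_quantile).
have m1E B : m1 B = c%:E * lam (`]0%R, 1%R[ `&` quantile @^-1` B).
  by rewrite setIC.
rewrite cE muleC -m1E; apply/esym.
apply: eq_measure_rat_rays => // q.
rewrite m1E quantile_preimage ray_massE lebesgue_measure_itv/= lte_fin.
case: ltP => q0; first by rewrite sube0 -EFinM mulrC.
have -> : ray_mass (ratr q) = 0%R by apply/eqP; rewrite eq_le q0 ray_mass_ge0.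
by rewrite mul0r mule0.
Qed.

End quantile.

(** * Sets of positive finite measure as copies of the unit interval *)

Section nonatomic_isomorphism.
Context {R : realType} d (T : measurableType d).
Local Open Scope ereal_scope.
Notation TR := (measurableTypeR R).
Notation lam := (@lebesgue_measure R).
Variable m : {measure set T -> \bar R}.
Variables (phi : T -> TR) (chi : TR -> T).
Hypotheses (measurable_phi : measurable_fun setT phi).
Hypotheses (measurable_chi : measurable_fun setT chi).
Hypothesis phiK : cancel phi chi.
Hypothesis m1 : forall x, m [set x] = 0.

(** [phi] is injective, so it carries [m] on [E] to an atomless measure on the line; its quantile
    function followed by [chi] parametrises [E], and [ray_mass] after [phi] reads the parameter
    back. *)
Lemma nonatomic_isomorphism (E : set T) : measurable E -> 0 < m E -> m E < +oo ->
  exists (th : TR -> T) (ps : T -> TR), [/\ measurable_fun setT th,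
    measurable_fun setT ps,
    forall A, measurable A -> lam (`[0%R, 1%R] `&` th @^-1` A) * m E = m (A `&` E) &
    {ae lam, forall t, `[0%R, 1%R]%classic t -> ps (th t) = t}].
Proof.
move=> mE E0 Eoo.
pose nu : {measure set TR -> \bar R} := image_measure (mrestr m mE) measurable_phi.
have nuE A : nu A = m (phi @^-1` A `&` E) by [].
have nuT : nu setT = m E by rewrite nuE preimage_setT setTI.
have nuT0 : 0 < nu setT by rewrite nuT.
have nuToo : nu setT < +oo by rewrite nuT.
have mphi A : measurable A -> measurable (phi @^-1` A).
  by move=> mA; rewrite -[X in measurable X]setTI; exact: measurable_phi.
have mchi A : measurable A -> measurable (chi @^-1` A).
  by move=> mA; rewrite -[X in measurable X]setTI; exact: measurable_chi.
have nu1 x : nu [set x] = 0.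
  apply/eqP; rewrite eq_le measure_ge0 andbT nuE.
  have mx : measurable (phi @^-1` [set x]) by apply: mphi; exact: measurable_set1.
  have [[y yx]|nx] := pselect (exists y, phi y = x).
    have px : phi @^-1` [set x] = [set y].
      by apply/seteqP; split=> z /= => [|->//]; rewrite -yx => /(can_inj phiK).
    rewrite -(m1 y) -px; apply: le_measure; rewrite ?inE//; exact: measurableI.
  rewrite (_ : _ `&` _ = set0) ?measure0//.
  by apply/seteqP; split => // z [/= zx _]; apply: nx; exists z.
have mq := measurable_quantile nuT0 nuToo.
exists (chi \o quantile nu), (ray_mass nu \o phi); split.
- exact: measurableT_comp.
- apply: measurableT_comp => //.
  by apply: nondecreasing_measurable => //; exact: ray_mass_nd.
- move=> A mA; rewrite -nuT comp_preimage pushforward_quantile//; last exact: mchi.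
  rewrite nuE -comp_preimage; congr (m (_ `&` _)).
  by apply/seteqP; split=> x /=; rewrite phiK.
(* [N] is the complement of the range of [phi], hence [nu]-null. *)
pose N : set TR := [set r | (phi (chi r) == r) = false].
have mN : measurable N.
  have : measurable_fun [set: TR] (fun r : TR => phi (chi r) == r).
    by apply: measurable_fun_eqr => //; exact: measurableT_comp.
  by move=> /(_ measurableT [set false]); rewrite setTI; apply.
have N0 : nu N = 0.
  rewrite nuE (_ : _ `&` _ = set0) ?measure0//.
  by apply/seteqP; split=> // x [] /=; rewrite /N/= phiK eqxx.
(* The endpoints are exceptional because [quantileK] holds only on the open interval. *)
exists ((`[0%R, 1%R] `&` quantile nu @^-1` N) `|` [set 0%R; 1%R]).
have mQN : measurable (`[0%R, 1%R] `&` quantile nu @^-1` N : set TR).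
  apply: measurableI; first exact: measurable_itv.
  by rewrite -[X in measurable X]setTI; exact: mq.
have m01 : measurable ([set 0%R; 1%R] : set TR) by apply: measurableU.
split; first exact: measurableU.
- rewrite measureU0//.
    have /eqP := pushforward_quantile nuT0 nuToo mN.
    by rewrite N0 mule_eq0 (gt_eqF nuT0) orbF => /eqP.
  by rewrite measureU0//; exact: lebesgue_measure_set1.
move=> t /=; apply: contra_notP => /not_orP[nQ /not_orP[t0 t1]] t01.
have t01' : (0 < t < 1)%R.
  move: t01; rewrite /= in_itv/= => /andP[h0 h1].
  by rewrite !lt_neqAle h0 h1 eq_sym !andbT; apply/andP; split; exact/eqP.
have /eqP qE : phi (chi (quantile nu t)) == quantile nu t.
  by apply: contra_notT nQ => h; split => //=; apply/negbTE.
by rewrite /= qE quantileK.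
Qed.

End nonatomic_isomorphism.

(** * Countable and uncountable index sets *)

Section countability.

Lemma countable_enum (I : pointedType) (D : set I) : countable D ->
  exists e : nat -> I, D `<=` range e.
Proof.
move=> /countable_injP[f injf]; exists (fun n => xget point [set j | D j /\ f j = n]).
move=> j Dj; exists (f j) => //.
have : (xget point [set k | D k /\ f k = f j]) \in [set k | D k /\ f k = f j].
  by apply/mem_set; apply: xgetPex; exists j.
by rewrite inE => -[Dk fk]; apply: injf; rewrite ?inE.
Qed.

(** Cantor's diagonal: [d] differs at [n] from the sequence coded by [n]. *)
Lemma uncountable_bool_seq : ~ countable [set: nat -> bool].
Proof.
move=> /countable_injP[f injf].
pose d n := ~~ xget (fun=> false) [set b | f b = n] n.
have : f (xget (fun=> false) [set b | f b = f d]) = f d.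
  by apply: (@xgetPex _ _ [set b | f b = f d]); exists d.
move=> /(injf _ _ (mem_set I) (mem_set I)) dE.
have : d (f d) = ~~ d (f d) by rewrite {1}/d dE.
by case: (d (f d)).
Qed.

(** For each [n] only finitely many terms reach [n.+1%:R^-1], as otherwise some finite partial sum
    would exceed the total. *)
Lemma esum_countable (R : realType) (I : choiceType) (a : I -> \bar R) :
  (forall i, 0 <= a i)%E -> (\esum_(i in setT) a i < +oo)%E ->
  countable [set i | 0 < a i]%E.
Proof.
move=> a0 aoo.
rewrite (_ : [set i | _] = \bigcup_n [set i | (n.+1%:R^-1)%:E <= a i]%E).
  apply: bigcup_countable => // n _.
  apply: finite_set_countable; apply: contrapT => inf.
  have afin : \esum_(i in setT) a i \is a fin_num.
    by rewrite ge0_fin_numE// esum_ge0.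
  pose M := fine (\esum_(i in setT) a i).
  have M0 : 0 <= M by rewrite fine_ge0// esum_ge0.
  (* With this many terms of size at least [n.+1%:R^-1], the sum reaches [Num.bound M], which
     exceeds [M]. *)
  pose k := (Num.bound M * n.+1)%N.
  have [B BI Bk] := infinite_set_fset k inf.
  have h1 : (\sum_(i <- B) (n.+1%:R^-1)%:E <= \sum_(i <- B) a i)%E.
    by rewrite big_seq [leRHS]big_seq; apply: lee_sum => i iB; exact: BI.
  have h2 : (\sum_(i <- B) a i <= M%:E)%E.
    rewrite /M fineK//; apply: ereal_sup_ubound; exists [set` B]; first by split.
    by rewrite fsbig_finite//= set_fsetK.
  have h3 : ((k%:R * n.+1%:R^-1)%:E <= \sum_(i <- B) (n.+1%:R^-1 : R)%:E)%E.
    rewrite sumEFin lee_fin big_const_seq count_predT iter_addr_0.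
    by rewrite -[leRHS]mulr_natl ler_wpM2r ?invr_ge0 ?ler_nat.
  have := le_trans h3 (le_trans h1 h2).
  rewrite lee_fin natrM mulfK// leNgt => /negP; apply.
  exact: archi_boundP.
apply/seteqP; split=> i /=.
  case ai: (a i) (a0 i) => [r| |]// _; last by move=> _; exists 0%N => //=; rewrite ai leey.
  rewrite lte_fin => /ltr_add_invr[k]; rewrite add0r => /ltW h.
  by exists k => //=; rewrite ai lee_fin.
by move=> [n _ /=]; apply: lt_le_trans; rewrite lte_fin invr_gt0.
Qed.

End countability.

(** * Families with null overlaps, and a maximal one indexed by the reals *)

Section almost_disjoint.
Context {R : realType} d (T : measurableType d).
Local Open Scope ereal_scope.
Variable m : {measure set T -> \bar R}.

Section family.
Variables (I : choiceType) (F : I -> set T).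
Hypothesis mF : forall i, measurable (F i).
Hypothesis F0 : forall i j, i != j -> m (F i `&` F j) = 0.

(** Removing the null set [N] of all pairwise overlaps makes the sets disjoint without changing any
    integral. *)
Lemma integral_almost_disjoint (s : seq I) (h : T -> \bar R) : uniq s ->
  measurable_fun setT h -> (forall x, 0 <= h x) ->
  \int[m]_(x in \big[setU/set0]_(i <- s) F i) h x = \sum_(i <- s) \int[m]_(x in F i) h x.
Proof.
move=> us mh h0.
pose N := \big[setU/set0]_(i <- s) \big[setU/set0]_(j <- s | i != j) (F i `&` F j).
have [mN N0] : measurable N /\ m N = 0.
  apply: (big_ind (fun X => measurable X /\ m X = 0)) => [|X Y [mX X0] [mY Y0]|i _].
  - by split.
  - by split; [exact: measurableU|rewrite measureU0].
  - apply: (big_ind (fun X => measurable X /\ m X = 0)) => [|X Y [mX X0] [mY Y0]|j ij].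
    + by split.
    + by split; [exact: measurableU|rewrite measureU0].
    + by split; [exact: measurableI|exact: F0].
have mU : measurable (\big[setU/set0]_(i <- s) F i) by exact: bigsetU_measurable.
rewrite (ge0_negligible_integral mN)//; last exact: measurable_funTS.
rewrite setDE big_distrl/=.
rewrite ge0_integral_bigsetU//=; last 3 first.
- by move=> i; apply: measurableI => //; exact: measurableC.
- move=> i j /= si sj [x [[Fix Nx] [Fjx _]]]; apply: contrapT => /eqP ij; apply: Nx.
  rewrite /N -bigcup_seq; exists i => //=.
  by rewrite -bigcup_seq_cond; exists j => //=; rewrite sj ij.
- exact: measurable_funTS.
apply: eq_bigr => i _; rewrite -setDE -ge0_negligible_integral//.
exact: measurable_funTS.
Qed.

Lemma esum_integral_almost_disjoint_le (h : T -> \bar R) :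
  measurable_fun setT h -> (forall x, 0 <= h x) ->
  \esum_(i in setT) \int[m]_(x in F i) h x <= \int[m]_x h x.
Proof.
move=> mh h0; apply: ge_ereal_sup => _ [X [finX _] <-].
rewrite fsbig_finite//= -integral_almost_disjoint//.
apply: ge0_subset_integral => //; first exact: bigsetU_measurable.
Qed.

(** Integrating the indicator of [A] shows that the masses the family cuts out of [A] sum to at most
    [m A]. *)
Lemma almost_disjoint_countable (A : set T) : measurable A -> m A < +oo ->
  countable [set i | 0 < m (A `&` F i)].
Proof.
move=> mA Aoo; apply: esum_countable => //.
apply: le_lt_trans Aoo.
have mi : measurable_fun [set: T] (fun x => (\1_A x : R)%:E).
  by apply/measurable_EFinP; exact: measurable_indic.
have /= := @esum_integral_almost_disjoint_le _ mi _.
rewrite integral_indic// setIT; under eq_esum do rewrite integral_indic//.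
by apply => x; rewrite lee_fin.
Qed.

End family.

(** The last clause replaces covering the space: [m] may fail to be sigma-finite, so exhaustion is
    asked only of sets of finite measure. *)
Definition almost_partition (I : choiceType) (F : I -> set T) : Prop :=
  [/\ forall i, [/\ measurable (F i), 0 < m (F i) & m (F i) < +oo],
      forall i j, i != j -> m (F i `&` F j) = 0 &
      forall A, measurable A -> m A < +oo ->
        (forall i, m (A `&` F i) = 0) -> m A = 0].

Lemma ex_maximal_family : exists EE : set (set T),
  [/\ forall E, EE E -> [/\ measurable E, 0 < m E & m E < +oo],
      forall A B, EE A -> EE B -> A <> B -> m (A `&` B) = 0 &
      forall A, measurable A -> m A < +oo ->
        (forall E, EE E -> m (A `&` E) = 0) -> m A = 0].
Proof.
pose P (EE : set (set T)) :=
  (forall E, EE E -> [/\ measurable E, 0 < m E & m E < +oo]) /\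
  (forall A B, EE A -> EE B -> A <> B -> m (A `&` B) = 0).
have [X XP totX|EE [[EE1 EE2] maxE]] := @Zorn_bigcup _ P.
  split=> [E [Y XY YE]|A B [Y XY YA] [Z XZ ZB] AB].
    by have [/(_ _ YE)] := XP _ XY.
  have [YZ|ZY] := totX _ _ XY XZ.
    by have [_] := XP _ XZ; apply => //; exact: YZ.
  by have [_] := XP _ XY; apply => //; exact: ZY.
exists EE; split => // A mA Aoo AE; apply: contrapT => /eqP A0.
have Apos : 0 < m A by rewrite lt0e A0 measure_ge0.
have nA : ~ EE A.
  by move=> /AE; rewrite setIid; exact/eqP.
(* A non-null [A] that is null on every member could be adjoined to the maximal family. *)
apply: (maxE (A |` EE)).
  split; first by move=> E; right.
  by move=> /(_ A (or_introl erefl)).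
split=> [E [->//|/EE1//]|B C [->|EB] [->|EC] BC].
- by case: BC.
- exact: AE.
- by rewrite setIC; exact: AE.
- exact: EE2.
Qed.

(** Each [S n] meets only countably many members in positive measure; what remains of it outside
    these is null on every member, hence null. *)
Lemma almost_partition_exhaust (I : pointedType) (F : I -> set T) (S : nat -> set T) :
  almost_partition F -> (forall n, measurable (S n)) -> (forall n, m (S n) < +oo) ->
  exists e : nat -> I, forall n, m (S n `\` \bigcup_k F (e k)) = 0.
Proof.
move=> [F1 F2 F3] mS Soo.
have mF i : measurable (F i) by case: (F1 i).
have cJ : countable (\bigcup_n [set i | 0 < m (S n `&` F i)]).
  by apply: bigcup_countable => // n _; exact: almost_disjoint_countable.
have [e eJ] := countable_enum cJ; exists e => n.
have mU : measurable (\bigcup_k F (e k)) by exact: bigcupT_measurable.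
have mD : measurable (S n `\` \bigcup_k F (e k)) by exact: measurableD.
apply: F3 => //.
  by apply: le_lt_trans (Soo n); apply: le_measure; rewrite ?inE//; exact: subDsetl.
move=> i; have [|i0] := pselect (0 < m (S n `&` F i)).
  move=> i0; have [|k _ ei] := eJ i; first by exists n.
  rewrite (_ : _ `&` _ = set0) ?measure0//.
  by apply/seteqP; split=> // x [[_ nF] Fx]; apply: nF; exists k => //; rewrite ei.
apply/eqP; rewrite eq_le measure_ge0 andbT.
apply: (@le_trans _ _ (m (S n `&` F i))); last by rewrite leNgt; exact/negP.
apply: le_measure; rewrite ?inE; [exact: measurableI|exact: measurableI|].
by apply: setSI; exact: subDsetl.
Qed.

Section ex_almost_partition.
Notation TR := (measurableTypeR R).
Variables (phi : T -> TR) (chi : TR -> T).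
Hypotheses (measurable_phi : measurable_fun setT phi).
Hypotheses (measurable_chi : measurable_fun setT chi).
Hypothesis phiK : cancel phi chi.

(* A finite-measure set is determined, up to almost disjointness, by the
   distribution function that [phi] has on it at the rationals. *)
Definition set_code (E : set T) : R :=
  RN_code (fun n : nat => if unpickle n is Some q then
    fine (m (phi @^-1` `]-oo, ratr (q : rat)[%classic `&` E)) else 0%R).

(** Equal codes would give [A] and [B] the same image measure on the line; at the preimage of [A]
    under [chi] one takes the value [m A], the other that of the null overlap. *)
Lemma set_code_inj (A B : set T) : measurable A -> measurable B ->
  0 < m A -> m A < +oo -> m B < +oo -> m (A `&` B) = 0 ->
  set_code A <> set_code B.
Proof.
move=> mA mB A0 Aoo Boo AB0 /(can_inj RN_codeK) cAB.
pose nu E (mE : measurable E) : {measure set TR -> \bar R} :=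
  image_measure (mrestr m mE) measurable_phi.
have mphi X : measurable X -> measurable (phi @^-1` X).
  by move=> mX; rewrite -[X in measurable X]setTI; exact: measurable_phi.
have mchi X : measurable X -> measurable (chi @^-1` X).
  by move=> mX; rewrite -[X in measurable X]setTI; exact: measurable_chi.
have nuA := @eq_measure_rat_rays _ (nu A mA) (nu B mB).
have : nu A mA (chi @^-1` A) = nu B mB (chi @^-1` A).
  apply: nuA; last exact: mchi.
    by rewrite /nu image_measureE /= /mrestr preimage_setT setTI.
  move=> q; rewrite /nu !image_measureE /= /mrestr.
  have mI E : measurable E -> measurable (phi @^-1` `]-oo, (ratr q : R)[ `&` E).
    by move=> mE; apply: measurableI => //; apply: mphi; exact: measurable_itv.
  have fI E : measurable E -> m E < +oo ->
      m (phi @^-1` `]-oo, (ratr q : R)[ `&` E) \is a fin_num.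
    move=> mE Eoo; rewrite ge0_fin_numE//; apply: le_lt_trans Eoo.
    by apply: le_measure; rewrite ?inE//; exact: mI.
  have /= := congr1 (fun x => x (pickle q)) cAB; rewrite pickleK/= => h.
  by rewrite -(fineK (fI _ mA Aoo)) -(fineK (fI _ mB Boo)) h.
rewrite /nu !image_measureE /= /mrestr -comp_preimage.
have -> : (chi \o phi) @^-1` A = A by apply/seteqP; split=> x /=; rewrite phiK.
by rewrite setIid AB0 => A0'; rewrite A0' ltxx in A0.
Qed.

Lemma ex_almost_partition (K : (nat -> bool) -> set T) : CH R ->
  (forall b, [/\ measurable (K b), 0 < m (K b) & m (K b) < +oo]) ->
  (forall b b', b <> b' -> K b `&` K b' = set0) ->
  exists F : R -> set T, almost_partition F.
Proof.
move=> ch K1 K2; have [EE [EE1 EE2 EE3]] := ex_maximal_family.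
have inj_code : {in EE &, injective set_code}.
  move=> A B; rewrite !inE => EA EB; apply: contraPP => AB.
  have [mA A0 Aoo] := EE1 _ EA; have [mB B0 Boo] := EE1 _ EB.
  by apply: set_code_inj => //; exact: EE2.
(* By maximality every [K b] meets some member in positive measure, while each member does so with
   countably many [K b]. *)
have ucEE : ~ countable EE.
  move=> cEE; apply: uncountable_bool_seq.
  have cB : countable (\bigcup_(E in EE)
      [set b : {classic (nat -> bool)} | 0 < m (E `&` K b)]).
    apply: bigcup_countable => // E EE_E; have [mE _ Eoo] := EE1 _ EE_E.
    apply: almost_disjoint_countable => // [b|b b' bb']; first by case: (K1 b).
    by rewrite K2 ?measure0//; exact/eqP.
  suff <- : \bigcup_(E in EE) [set b : nat -> bool | 0 < m (E `&` K b)] = setT by [].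
  apply/seteqP; split=> // b _; have [mKb Kb0 Kboo] := K1 b.
  apply: contrapT => no; have : m (K b) = 0.
    apply: EE3 => // E EE_E; apply/eqP; apply: contrapT => /negP h; apply: no.
    by exists E => //=; rewrite setIC lt0e h measure_ge0.
  by move=> h; rewrite h ltxx in Kb0.
have cardE : (set_code @` EE #= EE)%card by exact: inj_card_eq.
have cEE : (EE #= [set: R])%card.
  apply: card_eq_trans (card_esym cardE) _.
  (* CH enters here: the codes form an uncountable set of reals. *)
  have [|//] := ch (set_code @` EE).
  by rewrite (eq_countable cardE).
have /card_set_bijP[F [FE Fi Fs]] := card_esym cEE.
have EF i : EE (F i) by apply: FE.
exists F; split=> [i|i j ij|A mA Aoo AF].
- exact: EE1.
- apply: EE2 => // /Fi h; move/eqP: ij; apply; apply: h; by rewrite inE.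
- by apply: EE3 => // E /Fs[i _ <-].
Qed.

End ex_almost_partition.

End almost_disjoint.

(** * Integrals as sums over the partition *)

Section partition_integral.
Context {R : realType} d (T : measurableType d).
Local Open Scope ereal_scope.
Variable m : {measure set T -> \bar R}.

(** Countably many members carry [h] up to a null set, and the integral over their union is a limit
    of integrals over finite unions, each a finite partial sum. *)
Lemma esum_integral_partition (I : pointedType) (F : I -> set T) (S : nat -> set T)
    (h : T -> \bar R) :
  almost_partition m F -> (forall n, measurable (S n)) -> (forall n, m (S n) < +oo) ->
  measurable_fun setT h -> (forall x, 0 <= h x) ->
  (forall x, h x != 0 -> (\bigcup_n S n) x) ->
  \esum_(i in setT) \int[m]_(x in F i) h x = \int[m]_x h x.
Proof.
move=> FP mS Soo mh h0 hS; have [F1 F2 _] := FP.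
have mF i : measurable (F i) by case: (F1 i).
apply/eqP; rewrite eq_le esum_integral_almost_disjoint_le//=.
have [e eS] := almost_partition_exhaust FP mS Soo.
set U := \bigcup_k F (e k) in eS.
have mU : measurable U by exact: bigcupT_measurable.
have -> : \int[m]_x h x = \int[m]_(x in U) h x.
  rewrite -(setUv U) ge0_integral_setU//; last 3 first.
  - exact: measurableC.
  - exact: measurable_funTS.
  - by apply/disj_setPCl.
  rewrite [X in _ + X](_ : _ = 0) ?adde0//.
  pose N := \bigcup_n (S n `\` U).
  have mSU n : measurable (S n `\` U) by exact: measurableD.
  have mN : measurable N by exact: bigcupT_measurable.
  have N0 : m N = 0.
    apply/eqP; rewrite eq_le measure_ge0 andbT.
    apply: (le_trans (measure_sigma_subadditive _ _ mN (@subset_refl _ N))) => //.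
    by rewrite eseries0// => n _ _; exact: eS.
  rewrite (ge0_negligible_integral mN)//; last 2 first.
  - exact: measurableC.
  - exact: measurable_funTS.
  apply: integral0_eq => x [Ux Nx]; apply/eqP; apply: contrapT => /negP /hS[n _ Sx].
  by apply: Nx; exists n.
pose G n := \big[setU/set0]_(k < n) F (e k).
have mG n : measurable (G n) by exact: bigsetU_measurable.
have cG : \int[m]_(x in G n) h x @[n --> \oo] --> \int[m]_(x in U) h x.
  have -> : U = \bigcup_n G n.
    apply/seteqP; split=> [x [k _ Fx]|x [n _]].
      by exists k.+1 => //; rewrite /G -(bigcup_mkord k.+1 (fun k => F (e k))); exists k => /=.
    by rewrite /G -(bigcup_mkord n (fun k => F (e k))) => -[k _ Fx]; exists k.
  apply: (@ge0_nondecreasing_set_cvg_integral _ _ _ G) => //.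
    move=> i j ij; apply/subsetPset; rewrite /G.
    rewrite -(bigcup_mkord i (fun k => F (e k))) -(bigcup_mkord j (fun k => F (e k))).
    by move=> x [k ki Fx]; exists k => //=; exact: leq_trans ij.
  by move=> n; exact: measurable_funTS.
rewrite -(cvg_lim _ cG)//; apply: lime_le; first by apply/cvg_ex; eexists; exact: cG.
(* The enumeration [e] may repeat members, hence [undup]. *)
apply: nearW => n; pose s := undup (map e (iota 0 n)).
have -> : G n = \big[setU/set0]_(i <- s) F i.
  rewrite /G -(bigcup_mkord n (fun k => F (e k))) -bigcup_seq.
  apply/seteqP; split=> [x [k kn Fx]|x [i si Fx]].
    exists (e k) => //=; rewrite mem_undup; apply/mapP; exists k => //.
    by rewrite mem_iota add0n.
  move: si; rewrite /= mem_undup => /mapP[k]; rewrite mem_iota add0n /= => kn ik.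
  by exists k => //=; rewrite -ik.
rewrite integral_almost_disjoint ?undup_uniq//.
rewrite fsbig_seq ?undup_uniq//; apply: ereal_sup_ubound.
by exists [set` s] => //; split => //; exact: finite_seq.
Qed.

Lemma integral_mrestr (D : set T) (mD : measurable D) (h : T -> \bar R) :
  measurable_fun setT h -> (forall x, 0 <= h x) ->
  \int[mrestr m mD]_x h x = \int[m]_(x in D) h x.
Proof.
move=> mh h0.
rewrite (@ge0_negligible_integral _ _ _ (mrestr m mD) setT (~` D))//; last 2 first.
- exact: measurableC.
- by rewrite /= /mrestr setICl measure0.
rewrite setDE setCK setTI; apply: eq_measure_integral => A mA AD.
by rewrite /= /mrestr (setIidl AD).
Qed.

End partition_integral.

(** * Change of variables to the unit interval *)

Section change_of_variables.
Context {R : realType} d (T : measurableType d).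
Local Open Scope ereal_scope.
Notation TR := (measurableTypeR R).
Notation lam := (@lebesgue_measure R).
Variables (m : {measure set T -> \bar R}) (E : set T) (th : TR -> T).
Hypotheses (mE : measurable E) (Eoo : m E < +oo).
Hypothesis mth : measurable_fun setT th.
Hypothesis thE : forall A, measurable A ->
  lam (`[0%R, 1%R] `&` th @^-1` A) * m E = m (A `&` E).

(** By [thE], Lebesgue measure on [[0, 1]] pushed along [th] and scaled by [m E] is [m] restricted
    to [E]. *)
Lemma integral_unit_interval (h : T -> \bar R) : measurable_fun setT h ->
  (forall x, 0 <= h x) ->
  \int[lam]_(t in `[0%R, 1%R]) h (th t) * m E = \int[m]_(x in E) h x.
Proof.
move=> mh h0.
have m01 : measurable (`[0%R, 1%R]%classic : set TR) by exact: measurable_itv.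
have mhth : measurable_fun [set: TR] (fun t => h (th t)) by exact: measurableT_comp mth.
rewrite -(integral_mrestr _ m01)//.
rewrite -[X in X * _](@ge0_integral_pushforward _ _ _ _ _ th mth (mrestr lam m01) setT h)//.
rewrite -integral_mrestr//.
have c0 : (0 <= fine (m E))%R by exact: fine_ge0.
have -> : m E = (fine (m E))%:E by rewrite fineK// ge0_fin_numE.
rewrite muleC.
have -> : (fine (m E))%:E = (NngNum c0)%:num%:E by [].
rewrite -(ge0_integral_mscale (image_measure (mrestr lam m01) mth))//.
apply: eq_measure_integral => A mA _.
rewrite /= /mscale/= /mrestr fineK ?ge0_fin_numE// -thE// muleC.
by rewrite setIC.
Qed.

Lemma ae_unit_interval (B : set T) : 0 < m E -> measurable B -> m (B `&` E) = 0 ->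
  {ae lam, forall t, `[0%R, 1%R]%classic t -> ~ B (th t)}.
Proof.
move=> E0 mB B0; exists (`[0%R, 1%R] `&` th @^-1` B); split.
- apply: measurableI; first exact: measurable_itv.
  by rewrite -[X in measurable X]setTI; exact: mth.
- have /eqP := thE mB; rewrite B0 mule_eq0 (gt_eqF E0) orbF => /eqP //.
- move=> t /= h; split; first by apply: contrapT => t01; apply: h.
  by apply: contrapT => nB; apply: h.
Qed.

End change_of_variables.

(** * Points and unit cubes under [mu] *)

Section baker_measure.
Context {R : realType}.
Local Open Scope ereal_scope.
Notation lam := (@lebesgue_measure R).

Lemma measurable_rect (C : nat -> set R) : (forall i, measurable (C i)) ->
  measurable (rect C : set (RN R)).
Proof.
move=> mC.
rewrite (_ : rect C = \bigcap_i ((fun x : RN R => (x : nat -> R) i) @^-1` (C i))).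
  apply: bigcapT_measurable => i.
  by rewrite -[X in measurable X]setTI; exact: measurable_coord.
by apply/seteqP; split=> [x Cx i _|x Cx i]; [exact: Cx|exact: (Cx i I)].
Qed.

Lemma mu_set1 (x : RN R) : mu [set x] = 0.
Proof.
have xE : [set x] = rect (fun i => [set (x : nat -> R) i]).
  apply/seteqP; split=> [y -> i//|y h]; apply/funext => i; exact: (h i).
have mx i : measurable [set (x : nat -> R) i] by exact: measurable_set1.
have [fx vx] := @null_rect R (fun i => [set (x : nat -> R) i]) 0%N mx
  (lebesgue_measure_set1 _).
rewrite xE muE; last exact: measurable_rect.
by apply/eqP; rewrite eq_le mu_star_ge0 andbT -vx mu_star_rect.
Qed.

(** The lowest corners range over the 0-1 sequences; half-open sides keep cubes with different
    corners disjoint. *)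
Definition unit_cube (b : nat -> bool) : set (RN R) :=
  rect (fun i => `[((b i)%:R : R), ((b i)%:R + 1)%R[%classic).

Lemma unit_cubeP b : [/\ measurable (unit_cube b), 0 < mu (unit_cube b) &
  mu (unit_cube b) < +oo].
Proof.
have mC i : measurable (`[((b i)%:R : R), ((b i)%:R + 1)%R[%classic) by exact: measurable_itv.
have C1 i : lam `[((b i)%:R : R), ((b i)%:R + 1)%R[%classic = 1.
  rewrite lebesgue_measure_itv/= lte_fin ltrDl ltr01 -EFinB.
  by rewrite addrAC subrr add0r.
have mK : measurable (unit_cube b) by exact: measurable_rect.
split => //; rewrite muE//.
  exact: lt_le_trans (mu_star_unit_cube mC C1).
have pv n : partial_vol (fun i => `[((b i)%:R : R), ((b i)%:R + 1)%R[%classic) n = 1.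
  by rewrite /partial_vol big1// => i _; exact: C1.
have cv : partial_vol (fun i => `[((b i)%:R : R), ((b i)%:R + 1)%R[%classic) @ \oo --> 1.
  by apply: cvg_near_cst; exact: nearW.
apply: (@le_lt_trans _ _ 1); last exact: ltry.
rewrite -[leRHS](cvg_lim _ cv)//; apply: mu_star_rect; split=> //.
by exists 1%R.
Qed.

Lemma unit_cube_disjoint b b' : b <> b' -> unit_cube b `&` unit_cube b' = set0.
Proof.
move=> bb'; apply/seteqP; split=> // x [xb xb']; apply: bb'; apply/funext => i.
move: (xb i) (xb' i); rewrite /= !in_itv/=.
by case: (b i); case: (b' i) => //= /andP[h1 h2] /andP[h3 h4]; lra.
Qed.

End baker_measure.

(** * Monotonicity of almost-everywhere statements *)

Section ae_lebesgue.
Context {R : realType}.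
Notation lam := (@lebesgue_measure R).

Lemma ae_lebesgueS (P Q : R -> Prop) : (forall t, P t -> Q t) ->
  {ae lam, forall t, P t} -> {ae lam, forall t, Q t}.
Proof.
move=> PQ [N [mN N0 PN]]; exists N; split=> // t /= nQ; apply: PN => /= Pt.
by apply: nQ; exact: PQ.
Qed.

Lemma ae_lebesgueS2 (P Q S : R -> Prop) : (forall t, P t -> Q t -> S t) ->
  {ae lam, forall t, P t} -> {ae lam, forall t, Q t} -> {ae lam, forall t, S t}.
Proof.
move=> PQS [N [mN N0 PN]] [M [mM M0 QM]]; exists (N `|` M); split.
- exact: measurableU.
- by rewrite measureU0.
move=> t /= nS; have [Pt|nP] := pselect (P t); last by left; exact: PN.
by right; apply: QM => /= Qt; apply: nS; exact: PQS.
Qed.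

End ae_lebesgue.

(** * The isometry and its surjectivity *)

Section isometry.
Context {R : realType}.
Local Open Scope ereal_scope.
Notation TR := (measurableTypeR R).
Notation lam := (@lebesgue_measure R).
Notation I01 := (`[0%R, 1%R]%classic : set R).
Variables (p : R) (F : R -> set (RN R)) (th : R -> TR -> RN R) (ps : R -> RN R -> TR).
Hypothesis p1 : (1 <= p)%R.
Hypothesis FP : almost_partition (@mu R) F.
Hypothesis mth : forall j, measurable_fun setT (th j).
Hypothesis mps : forall j, measurable_fun setT (ps j).
Hypothesis thE : forall j A, measurable A ->
  lam (`[0%R, 1%R] `&` th j @^-1` A) * mu (F j) = mu (A `&` F j).
Hypothesis psK : forall j, {ae lam, forall t, I01 t -> ps j (th j t) = t}.

Let p_gt0 : (0 < p)%R. Proof. exact: lt_le_trans p1. Qed.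

Let mF j : measurable (F j). Proof. by case: FP => /(_ j)[]. Qed.
Let F_gt0 j : 0 < mu (F j). Proof. by case: FP => /(_ j)[]. Qed.
Let F_oo j : mu (F j) < +oo. Proof. by case: FP => /(_ j)[]. Qed.
Let F_disj i j : i != j -> mu (F i `&` F j) = 0. Proof. by case: FP => _ /(_ i j). Qed.

(** The unit interval has mass 1 and [F j] has mass [mu (F j)]; this factor compensates in the [L^p]
    norm. *)
Definition mass_root (j : R) : R := (fine (mu (F j)) `^ p^-1)%R.

Lemma mass_root_gt0 j : (0 < mass_root j)%R.
Proof. by rewrite powR_gt0// fine_gt0// F_gt0 F_oo. Qed.

Lemma mass_rootX j : ((mass_root j `^ p)%R)%:E = mu (F j).
Proof.
rewrite /mass_root -powRrM mulVf ?gt_eqF// powRr1 ?fine_ge0//.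
by rewrite fineK// ge0_fin_numE.
Qed.

Definition unfold_map (f : RN R -> R) (j t : R) : R := (f (th j t) * mass_root j)%R.

Lemma measurable_powR_norm d (T : measurableType d) (D : set T) (f : T -> R) :
  measurable_fun D f -> measurable_fun D (fun x => (`|f x| `^ p)%:E).
Proof.
move=> mf; apply/measurable_EFinP.
apply: (@measurableT_comp _ _ _ _ _ _ (fun x : R => (x `^ p)%R) _ (fun x => `|f x|%R)).
  exact: measurable_powR.
exact: measurableT_comp.
Qed.

Lemma powR_norm_ge0 (x : R) : 0 <= (`|x| `^ p)%:E.
Proof. by rewrite lee_fin powR_ge0. Qed.

Lemma measurable_unfold_map (f : RN R -> R) j : measurable_fun setT f ->
  measurable_fun [set: TR] (unfold_map f j).
Proof.
by move=> mf; apply: measurable_funM => //; exact: (measurableT_comp mf (mth j)).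
Qed.

Lemma integral_unfold_map (f : RN R -> R) j : measurable_fun setT f ->
  \int[lam]_(t in I01) (`|unfold_map f j t| `^ p)%:E =
  \int[@mu R]_(x in F j) (`|f x| `^ p)%:E.
Proof.
move=> mf.
rewrite -(integral_unit_interval (mF j) (F_oo j) (mth j) (@thE j)); last 2 first.
- exact: measurable_powR_norm.
- by move=> x; exact: powR_norm_ge0.
rewrite -[X in _ * X]mass_rootX.
transitivity (\int[lam]_(t in I01) ((`|f (th j t)| `^ p)%:E * (mass_root j `^ p)%:E)).
  apply: eq_integral => t _; rewrite /unfold_map normrM powRM//.
  by rewrite (gtr0_norm (mass_root_gt0 j)) EFinM.
rewrite ge0_integralZr//.
- apply: (@measurable_powR_norm _ TR I01 (fun t => f (th j t))).
  by apply: measurable_funTS; exact: (measurableT_comp mf (mth j)).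
- by rewrite lee_fin powR_ge0.
Qed.

Lemma Lp01_normX g : poweR (Lp01_norm p g) p =
  \int[lam]_(t in I01) (`|g t| `^ p)%:E.
Proof.
rewrite /Lp01_norm -poweRrM mulVf ?gt_eqF// poweRe1//.
by apply: integral_ge0 => t _; exact: powR_norm_ge0.
Qed.

Lemma esum_unfold_map (f : RN R -> R) (S : nat -> set (RN R)) : measurable_fun setT f ->
  (forall n, measurable (S n)) -> (forall n, mu (S n) < +oo) ->
  (forall x, f x != 0%R -> (\bigcup_n S n) x) ->
  \esum_(j in setT) poweR (Lp01_norm p (unfold_map f j)) p =
  \int[@mu R]_x (`|f x| `^ p)%:E.
Proof.
move=> mf mS Soo fS.
rewrite -(@esum_integral_partition _ _ _ (@mu R) _ F S)//.
- by apply: eq_esum => j _; rewrite Lp01_normX integral_unfold_map.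
- exact: measurable_powR_norm.
- move=> x; rewrite eqe powR_eq0 negb_and normr_eq0 => /orP[/fS//|].
  by rewrite negbK gt_eqF.
Qed.

(** The sets where the [p]-th power of [|f|] is at least [n.+1%:R^-1] have finite measure by
    Markov's inequality and exhaust the support. *)
Lemma Lp_mu_sigma_finite (f : RN R -> R) : Lp_mu p f -> exists S : nat -> set (RN R),
  [/\ forall n, measurable (S n), forall n, mu (S n) < +oo &
      forall x, f x != 0%R -> (\bigcup_n S n) x].
Proof.
move=> [mf foo].
pose h x := (`|f x| `^ p)%:E.
have mh : measurable_fun [set: RN R] h by exact: measurable_powR_norm.
have h0 x : 0 <= h x by exact: powR_norm_ge0.
exists (fun n => [set x | (n.+1%:R^-1)%:E <= h x]).
have mS n : measurable [set x | (n.+1%:R^-1 : R)%:E <= h x].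
  have := mh measurableT `[(n.+1%:R^-1 : R)%:E, +oo[%classic.
  rewrite setTI (_ : _ @^-1` _ = [set x | (n.+1%:R^-1 : R)%:E <= h x]).
    by apply; exact: emeasurable_itv.
  by apply/seteqP; split=> x /=; rewrite in_itv/= andbT.
split=> // [n|x fx].
- have a0 : (0 < n.+1%:R^-1 :> R)%R by rewrite invr_gt0.
  have := @le_integral_abse _ _ _ (@mu R) setT measurableT h _ mh a0.
  have absE : (fun x => `|h x|) = h by apply/funext => x; rewrite gee0_abs.
  rewrite setTI (_ : [set x | (n.+1%:R^-1 : R)%:E <= `|h x|] =
    [set x | (n.+1%:R^-1 : R)%:E <= h x]); last by rewrite -[in RHS]absE.
  rewrite absE.
  move=> le; rewrite ltey; apply/eqP => S_oo; have := le_lt_trans le foo.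
  by rewrite [X in _ * X]S_oo gt0_muley// ltxx.
- have : (0 < `|f x| `^ p)%R by rewrite powR_gt0// normr_gt0.
  move=> /ltr_add_invr[k]; rewrite add0r => /ltW hk.
  by exists k => //=; rewrite lee_fin.
Qed.

Lemma unfold_map_ae (f g : RN R -> R) : mu_ae (fun x => f x = g x) ->
  forall j, ae01_eq (unfold_map f j) (unfold_map g j).
Proof.
move=> [N [mN [N0 fgN]]] j.
have N0j : mu (N `&` F j) = 0.
  apply/eqP; rewrite eq_le measure_ge0 andbT -N0.
  by apply: le_measure; rewrite ?inE//; exact: measurableI.
have := ae_unit_interval (mth j) (@thE j) (F_gt0 j) mN N0j.
apply: ae_lebesgueS => t h /h nN; rewrite /unfold_map; congr (_ * _)%R.
by apply: contrapT => fg; apply: nN; apply: fgN.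
Qed.

Lemma unfold_map_lp (f : RN R -> R) : Lp_mu p f -> lp_fam p (unfold_map f).
Proof.
move=> fL; have [mf foo] := fL; split=> [j|].
  split; first by apply: measurable_funTS; exact: measurable_unfold_map.
  rewrite integral_unfold_map//; apply: le_lt_trans foo.
  apply: ge0_subset_integral => //; first exact: measurable_powR_norm.
have [S [mS Soo fS]] := Lp_mu_sigma_finite fL.
by rewrite (esum_unfold_map mf mS Soo fS).
Qed.

Lemma unfold_map_norm (f : RN R -> R) : Lp_mu p f ->
  lp_fam_norm p (unfold_map f) = Lp_mu_norm p f.
Proof.
move=> fL; have [mf foo] := fL; have [S [mS Soo fS]] := Lp_mu_sigma_finite fL.
by rewrite /lp_fam_norm (esum_unfold_map mf mS Soo fS).
Qed.

Section surjectivity.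
Variable G : R -> R -> R.
Hypothesis GL : lp_fam p G.
Variable e : nat -> R.
Hypothesis Ge : forall j, 0 < poweR (Lp01_norm p (G j)) p -> range e j.

(** Members may overlap in null sets; making them disjoint along [e] leaves a single member to read
    at each point. *)
Let piece (k : nat) : set (RN R) := seqDU (fun k => F (e k)) k.

Let mpiece k : measurable (piece k).
Proof. by apply: measurableD => //; exact: bigsetU_measurable. Qed.

(** [G j] is known to be measurable only on [[0, 1]], so it is cut off to 0 elsewhere before
    composing with [ps j]. *)
Let fold_piece (j : R) (x : RN R) : R :=
  (((G j) \_ I01) (ps j x) / mass_root j)%R.

Let mfold_piece j : measurable_fun setT (fold_piece j).
Proof.
apply: measurable_funM => //.
have mG : measurable_fun [set: TR] ((G j) \_ I01).
  apply/(measurable_restrictT _ _).1; first exact: measurable_itv.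
  by have [/(_ j)[]] := GL.
exact: (measurableT_comp mG (mps j)).
Qed.

Definition fold_map (x : RN R) : R :=
  if `[< (\bigcup_k piece k) x >] then fold_piece (e (xget 0%N [set k | piece k x])) x
  else 0%R.

Lemma fold_mapE k x : piece k x -> fold_map x = fold_piece (e k) x.
Proof.
move=> kx; rewrite /fold_map asboolT; last by exists k.
congr (fold_piece (e _) x).
have kx' : piece (xget 0%N [set k | piece k x]) x.
  by apply: (@xgetPex _ _ [set k | piece k x]); exists k.
by apply: (@trivIset_seqDU _ (fun k => F (e k))) => //; exists x.
Qed.

Lemma fold_map0 x : ~ (\bigcup_k F (e k)) x -> fold_map x = 0%R.
Proof. by move=> nx; rewrite /fold_map asboolF// -seqDU_bigcup_eq. Qed.

Lemma measurable_fold_map : measurable_fun setT fold_map.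
Proof.
have mU : measurable (\bigcup_k piece k) by exact: bigcupT_measurable.
rewrite -(setUv (\bigcup_k piece k)); apply/measurable_funU => //.
  exact: measurableC.
split.
  apply/measurable_fun_bigcup => // k.
  apply: (eq_measurable_fun (fold_piece (e k))); last exact: measurable_funTS.
  by move=> x; rewrite inE => /fold_mapE ->.
apply: (eq_measurable_fun (cst (0%R : R))); last exact: measurable_cst.
by move=> x; rewrite inE -seqDU_bigcup_eq => /fold_map0 ->.
Qed.

(** For enumerated [j], almost every [th j t] lies in [F j] and in no other enumerated member, so
    [fold_map] reads [G j] there; for other [j], both sides vanish almost everywhere. *)
Lemma unfold_fold_map j : ae01_eq (unfold_map fold_map j) (G j).
Proof.
(* [B] holds the points that could be read on a wrong member; its part in [F j] is null. *)
pose B := ~` F j `|` \bigcup_k (if e k == j then set0 else F (e k)).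
have mBk k : measurable (if e k == j then set0 else F (e k)) by case: ifP.
have mB : measurable B.
  by apply: measurableU; [exact: measurableC|exact: bigcupT_measurable].
have B0 : mu (B `&` F j) = 0.
  rewrite setIUl setICl set0U setI_bigcupl.
  have mI k : measurable ((if e k == j then set0 else F (e k)) `&` F j).
    exact: measurableI.
  have mU : measurable (\bigcup_k ((if e k == j then set0 else F (e k)) `&` F j)).
    exact: bigcupT_measurable.
  apply/eqP; rewrite eq_le measure_ge0 andbT.
  apply: (le_trans (measure_sigma_subadditive _ mI mU (@subset_refl _ _))).
  rewrite eseries0// => k _ _; case: ifPn => [_|/F_disj//].
  by rewrite set0I measure0.
have aeB := ae_unit_interval (mth j) (@thE j) (F_gt0 j) mB B0.
have [mG Goo] : Lp01 p (G j) by case: GL.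
have aeG : ~ range e j -> {ae lam, forall t, I01 t -> G j t = 0%R}.
  move=> nj.
  have : \int[lam]_(t in I01) (`|G j t| `^ p)%:E = 0.
    rewrite -Lp01_normX; apply/eqP; rewrite eq_le poweR_ge0 andbT leNgt.
    by apply/negP => /Ge.
  have m01 : measurable (I01 : set TR) by exact: measurable_itv.
  have mGp : measurable_fun (I01 : set TR) (fun t => (`|G j t| `^ p)%:E).
    exact: measurable_powR_norm.
  move=> h; have : \int[lam]_(t in I01) `|(`|G j t| `^ p)%:E| = 0.
    by rewrite -h; apply: eq_integral => t _; rewrite gee0_abs// powR_norm_ge0.
  move=> /(ae_eq_integral_abs lam m01 mGp).1; apply: ae_lebesgueS => t ht /ht.
  by move=> [] /powR_eq0_eq0/eqP; rewrite normr_eq0 => /eqP.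
have [rj|nj] := pselect (range e j); last first.
  have := aeG nj; move: aeB; apply: ae_lebesgueS2 => t h1 h2 t01.
  rewrite (h2 t01) /unfold_map fold_map0 ?mul0r// => -[k _ Fk].
  apply: (h1 t01); right; exists k => //; case: eqP => // ekj.
  by apply: nj; exists k.
move: (psK j) aeB; apply: ae_lebesgueS2 => t h1 h2 t01.
have {}h1 := h1 t01; have {}h2 := h2 t01.
have Fj : F j (th j t) by apply: contrapT => nF; apply: h2; left.
have : (\bigcup_k piece k) (th j t).
  by rewrite -seqDU_bigcup_eq; case: rj => k _ ek; exists k => //; rewrite ek.
move=> [k _ kt].
have ek : e k = j.
  apply: contrapT => /eqP ek; apply: h2; right; exists k => //.
  by rewrite (negbTE ek); case: kt.
rewrite /unfold_map (fold_mapE kt) ek /fold_piece h1 divfK ?gt_eqF ?mass_root_gt0//.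
by rewrite patchE mem_set.
Qed.

Lemma fold_map_Lp : Lp_mu p fold_map.
Proof.
split; first exact: measurable_fold_map.
rewrite -(@esum_unfold_map _ (fun k => F (e k)))//; last 2 first.
- exact: measurable_fold_map.
- by move=> x; apply: contraPP => /fold_map0 ->; rewrite eqxx.
have [GL1 GL2] := GL.
rewrite (eq_esum (b := fun j => poweR (Lp01_norm p (G j)) p))// => j _.
rewrite !Lp01_normX; have [mG _] := GL1 j.
apply: ge0_ae_eq_integral.
- exact: measurable_itv.
- apply: (@measurable_powR_norm _ TR I01 (unfold_map fold_map j)).
  apply: measurable_funTS; apply: measurable_unfold_map; exact: measurable_fold_map.
- exact: (@measurable_powR_norm _ TR I01 (G j)).
- by move=> t _; exact: powR_norm_ge0.
- by move=> t _; exact: powR_norm_ge0.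
have := unfold_fold_map j; apply: ae_lebesgueS => t h t01.
by rewrite (h t01).
Qed.

End surjectivity.

Lemma isometric_iso_of_partition : isometric_iso_Lp_mu_lp R p.
Proof.
exists unfold_map; split; first exact: unfold_map_lp.
split; first by move=> f g _ _; exact: unfold_map_ae.
split.
  move=> a b f g _ _ j; apply: aeW => t _; rewrite /unfold_map.
  by rewrite mulrDl !mulrA.
split; first exact: unfold_map_norm.
move=> G GL.
(* Summability leaves countably many nonzero components, which [e] enumerates. *)
have cG : countable [set j | 0 < poweR (Lp01_norm p (G j)) p].
  by apply: esum_countable => [j|]; [exact: poweR_ge0|case: GL].
have [e Ge] := countable_enum cG.
exists (fold_map G e); split; first exact: fold_map_Lp.
by move=> j; exact: unfold_fold_map.
Qed.

End isometry.

(** Under CH, for 1 <= p < oo, L^p(mu) is isometrically isomorphic to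
    l^p(c, L^p[0,1]); the index set of cardinality c is taken to be
    (the carrier of) R itself. *)
Theorem theorem1p1 (R : realType) (p : R) :
  CH R -> 1 <= p -> isometric_iso_Lp_mu_lp R p.
Proof.
move=> ch p1.
have [F FP] := ex_almost_partition (@measurable_RN_code R) (@measurable_RN_decode R)
  (@RN_codeK R) ch (@unit_cubeP R) (@unit_cube_disjoint R).
have [F1 _ _] := FP.
(* Packing the two maps into a pair lets one use of [choice] select both. *)
have iso j : exists tp : (measurableTypeR R -> RN R) * (RN R -> measurableTypeR R),
  [/\ measurable_fun setT tp.1, measurable_fun setT tp.2,
    forall A, measurable A ->
      (lebesgue_measure (`[0%R, 1%R] `&` tp.1 @^-1` A) * mu (F j) = mu (A `&` F j))%E &
    {ae @lebesgue_measure R, forall t, `[0%R, 1%R]%classic t -> tp.2 (tp.1 t) = t}].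
  have [mF F0 Foo] := F1 j.
  have [th [ps h]] := nonatomic_isomorphism (@measurable_RN_code R)
    (@measurable_RN_decode R) (@RN_codeK R) (@mu_set1 R) mF F0 Foo.
  by exists (th, ps).
have [tp tpP] := choice iso.
apply: (@isometric_iso_of_partition R p F (fun j => (tp j).1) (fun j => (tp j).2)) => //.
- by move=> j; case: (tpP j).
- by move=> j; case: (tpP j).
- by move=> j; case: (tpP j).
- by move=> j; case: (tpP j).
Qed.
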